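(* Let $k,h_1,h_2$ be positive integers with $k>\max\{h_1,h_2\}$ and $k\le h_1+h_2+1$. For each pair $(\alpha_1,\alpha_2)$ corresponding to a profile (that is, integers with $\alpha_1+\alpha_2=k+1$ and $1\le \alpha_j\le h_j$ for $j=1,2$), the variety of bifocal Grassmann tensors $\mathcal{X}_{(\alpha_1,\alpha_2)}$ is birational to a homogeneous space with respect to the action of $GL(h_1+1)\times GL(h_2+1)$.
   Context: All varieties are over $\mathbb{C}$. Let $V_j$ be a vector space of dimension $h_j+1$ with a fixed basis, $j=1,2$ (in the source, $V_j=U/C_j$, where $U$ is a $(k+1)$-dimensional vector space and $C_j\subset U$ is a $(k-h_j)$-dimensional subspace, the center of a linear projection). Let $\mathfrak{W}_0$ be the set of block matrices $[M_1|M_2]$, with $M_j$ a $(k+1)\times(h_j+1)$ matrix of maximal rank $h_j+1$, such that $C_1\cap C_2=\{0\}$, where $C_j=\ker(M_j^T)$; equivalently $[M_1|M_2]$ has rank $k+1$. The row space of $[M_1|M_2]$ is a point of the Grassmannian $G_1=G(k+1,V_1\oplus V_2)$ of $(k+1)$-dimensional subspaces, which is embedded by Plücker in $\mathbb{P}\left(\bigwedge^{k+1}(V_1\oplus V_2)\right)$. Let $\mathfrak{Q}_0\subset G_1$ be the open subset which is the image of $\mathfrak{W}_0$. The decomposition $\bigwedge^{k+1}(V_1\oplus V_2)=\bigoplus_{a_1+a_2=k+1}\bigwedge^{a_1}V_1\otimes\bigwedge^{a_2}V_2$ gives a linear projection $\pi:\mathbb{P}\left(\bigwedge^{k+1}(V_1\oplus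 V_2)\right)\dashrightarrow\mathbb{P}\left(\bigwedge^{\alpha_1}V_1\otimes\bigwedge^{\alpha_2}V_2\right)$. The variety of bifocal Grassmann tensors (generalized fundamental matrices) with profile $(\alpha_1,\alpha_2)$, denoted $\mathcal{X}_{(\alpha_1,\alpha_2)}$, is the Zariski closure of $\pi(\mathfrak{Q}_0)$. The group $GL(h_1+1)\times GL(h_2+1)$ acts on $\mathfrak{W}_0$ by $[M_1|M_2]\cdot(H_1,H_2)=[M_1H_1|M_2H_2]$; this induces actions on $\mathfrak{Q}_0$ and on $\mathcal{X}_{(\alpha_1,\alpha_2)}$. *)

(* Defs.v *)
From HB Require Import structures.
From mathcomp Require Import all_boot all_order all_algebra.
From mathcomp Require Import classical_sets reals complex mpoly.
Set Implicit Arguments.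
Unset Strict Implicit.
Unset Printing Implicit Defensive.
Import GRing.Theory.
Local Open Scope ring_scope.
Local Open Scope classical_set_scope.

(* Varieties are quasi-projective and classical: sets of closed points over a
   field K, to be instantiated by the complex numbers. *)

Section ProjectiveVarieties.
Context {K : fieldType}.

Definition grassmannian (r n : nat) := {L : {vspace 'rV[K]_n} | \dim L == r}.

(* Lines of K^n, hence of dimension n - 1 as a variety. *)
Definition projective (n : nat) := grassmannian 1 n.

Definition vanishes n (p : {mpoly K[n]}) (P : projective n) :=
  forall x : 'rV[K]_n, x \in val P -> p.@[x 0] = 0.

Definition zariski_closed n (Z : set (projective n)) :=
  exists2 S : set {mpoly K[n]},
    (forall p, S p -> exists d, p \is d.-homog) &
    Z = [set P | forall p, S p -> vanishes p P].

Definition zariski_closure n (X : set (projective n)) : set (projective n) :=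
  \bigcap_(Z in [set Z | zariski_closed Z /\ X `<=` Z]) Z.

Definition open_in n (X U : set (projective n)) :=
  exists2 Z, zariski_closed Z & U = X `\` Z.

Definition locally_closed n (X : set (projective n)) :=
  exists2 Z, zariski_closed Z & open_in Z X.

Definition irreducible n (X : set (projective n)) :=
  X !=set0 /\
  forall A B, zariski_closed A -> zariski_closed B ->
    X `<=` A `|` B -> X `<=` A \/ X `<=` B.

Definition variety n (X : set (projective n)) :=
  locally_closed X /\ irreducible X.

Definition poly_map n m (F : 'I_m -> {mpoly K[n]}) (x : 'rV[K]_n) : 'rV[K]_m :=
  \row_j (F j).@[x 0].

(* Around every point of U, f is given by homogeneous polynomials of a common
   degree without common zero at that point. *)
Definition morphism_on n m (U : set (projective n)) (Y : set (projective m))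
    (f : projective n -> projective m) :=
  (forall P, U P -> Y (f P)) /\
  forall P, U P -> exists (d : nat) (F : 'I_m -> {mpoly K[n]}),
    [/\ forall j, F j \is d.-homog,
        exists2 x, x \in val P & poly_map F x != 0 &
        forall Q x, U Q -> x \in val Q -> poly_map F x != 0 ->
          val (f Q) = <[poly_map F x]>%VS].

(* (U, f) represents a dominant rational map from X to Y. *)
Definition dominant_rational_map n m
    (X : set (projective n)) (Y : set (projective m))
    (U : set (projective n)) (f : projective n -> projective m) :=
  [/\ open_in X U, U !=set0, morphism_on U Y f &
      Y `<=` zariski_closure (f @` U)].

(* Two rational maps on a variety are equal iff they agree wherever both of the
   given representatives are defined. *)
Definition birational_equivalence n m
    (X : set (projective n)) (Y : set (projective m))
    (U : set (projective n)) (f : projective n -> projective m)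
    (V : set (projective m)) (g : projective m -> projective n) :=
  [/\ variety X /\ variety Y,
      dominant_rational_map X Y U f,
      dominant_rational_map Y X V g,
      forall P, U P -> V (f P) -> g (f P) = P &
      forall Q, V Q -> U (g Q) -> f (g Q) = Q].

(* [insubd] only matters when A is not injective on P. *)
Definition linear_act n (A : 'M[K]_n) (P : projective n) : projective n :=
  insubd P (linfun (mulmxr A : 'rV[K]_n -> 'rV[K]_n) @: val P)%VS.

End ProjectiveVarieties.

Section HomogeneousSpaces.
Context {K : fieldType}.
Variables n1 n2 : nat.

Definition matrix_pair := ('M[K]_n1 * 'M[K]_n2)%type.

Definition GL_pair : set matrix_pair :=
  [set g | g.1 \in unitmx /\ g.2 \in unitmx].

Definition mul_pair (g h : matrix_pair) : matrix_pair :=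
  (g.1 *m h.1, g.2 *m h.2).

Definition one_pair : matrix_pair := (1%:M, 1%:M).

Definition entries (g : matrix_pair) : 'rV[K]_(n1 * n1 + n2 * n2) :=
  row_mx (mxvec g.1) (mxvec g.2).

(* The variables of F j are the homogeneous coordinates of the point; its
   coefficients are polynomials in the entries of the two matrices. *)
Definition poly_act m
    (F : 'I_m -> {mpoly {mpoly K[n1 * n1 + n2 * n2]}[m]})
    (x : 'rV[K]_m) (g : matrix_pair) : 'rV[K]_m :=
  \row_j (map_mpoly (meval (entries g 0)) (F j)).@[x 0].

(* The map (y, g) |-> act y g is a morphism on Y x GL x GL. Inverses of the two
   determinants need not be adjoined: the local formulas can be multiplied by
   powers of the determinants. *)
Definition algebraic_action m (Y : set (projective m))
    (act : projective m -> matrix_pair -> projective m) :=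
  forall P g, Y P -> GL_pair g ->
  exists (d : nat) (F : 'I_m -> {mpoly {mpoly K[n1 * n1 + n2 * n2]}[m]}),
    [/\ forall j, F j \is d.-homog,
        exists2 x, x \in val P & poly_act F x g != 0 &
        forall Q h x, Y Q -> GL_pair h -> x \in val Q -> poly_act F x h != 0 ->
          val (act Q h) = <[poly_act F x h]>%VS].

Definition homogeneous_space m (Y : set (projective m))
    (act : projective m -> matrix_pair -> projective m) :=
  [/\ variety Y /\ algebraic_action Y act,
      forall P g, Y P -> GL_pair g -> Y (act P g),
      forall P, Y P -> act P one_pair = P,
      forall P g h, Y P -> GL_pair g -> GL_pair h ->
        act P (mul_pair g h) = act (act P g) h &
      forall P Q, Y P -> Y Q -> exists2 g, GL_pair g & act P g = Q].

End HomogeneousSpaces.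

Section BifocalGrassmannTensors.
Context {K : fieldType}.

(* I : wedge_index r n stands for the basis vector e_(I 0) ^ ... ^ e_(I (r-1))
   of the r-th exterior power of K^n, with I strictly increasing. *)
Definition wedge_index (r n : nat) :=
  {I : {ffun 'I_r -> 'I_n} |
    [forall i : 'I_r, forall j : 'I_r, (i < j)%N ==> (I i < I j)%N]}.

Definition wedge_dim (r n : nat) := #|{: wedge_index r n}|.

Definition pluecker_coordinates r n (M : 'M[K]_(r, n)) :
    'rV[K]_(wedge_dim r n) :=
  \row_i \det (colsub (val (enum_val i : wedge_index r n)) M).

Definition is_row_space r n (M : 'M[K]_(r, n)) (L : {vspace 'rV[K]_n}) :=
  forall v : 'rV[K]_n, (v \in L) = (v <= M)%MS.

Definition pluecker_point r n (L : grassmannian r n)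
    (P : projective (wedge_dim r n)) :=
  exists2 M : 'M[K]_(r, n), is_row_space M (val L) &
    val P = <[pluecker_coordinates M]>%VS.

(* The summand of the r-th exterior power of V1 (+) V2, for dim Vj = nj, that is
   the a1-th exterior power of V1 tensored with the a2-th one of V2 is spanned by
   the basis vectors having a1 indices in the first block and a2 in the
   second. *)
Definition bidegree_index (r n1 n2 a1 a2 : nat) :=
  {I : wedge_index r (n1 + n2) |
    (#|[pred i | (val I i < n1)%N]| == a1) &&
    (#|[pred i | (n1 <= val I i)%N]| == a2)}.

Definition bidegree_dim (r n1 n2 a1 a2 : nat) :=
  #|{: bidegree_index r n1 n2 a1 a2}|.

Definition bidegree_part r n1 n2 a1 a2
    (x : 'rV[K]_(wedge_dim r (n1 + n2))) :
    'rV[K]_(bidegree_dim r n1 n2 a1 a2) :=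
  \row_i x 0 (enum_rank (val (enum_val i : bidegree_index r n1 n2 a1 a2))).

(* Since P' is a line, P is off the center of the projection. *)
Definition projects_to r n1 n2 a1 a2
    (P : projective (wedge_dim r (n1 + n2)))
    (P' : projective (bidegree_dim r n1 n2 a1 a2)) :=
  exists2 x, x \in val P & val P' = <[bidegree_part a1 a2 x]>%VS.

Variables k h1 h2 : nat.

(* kermx Mj consists of the row vectors u with u *m Mj = 0: it is the
   transpose of the center Cj, the kernel of Mj^T. *)
Definition W0 (M1 : 'M[K]_(k.+1, h1.+1)) (M2 : 'M[K]_(k.+1, h2.+1)) :=
  [/\ \rank M1 = h1.+1, \rank M2 = h2.+1 &
      (kermx M1 :&: kermx M2)%MS = 0].

Definition Q0 : set (grassmannian k.+1 (h1.+1 + h2.+1)) :=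
  [set L | exists M1 M2, W0 M1 M2 /\ is_row_space (row_mx M1 M2) (val L)].

Variables a1 a2 : nat.

Definition bifocal_index := bidegree_index k.+1 h1.+1 h2.+1 a1 a2.

Definition bifocal_dim := bidegree_dim k.+1 h1.+1 h2.+1 a1 a2.

Definition projected_Q0 : set (projective bifocal_dim) :=
  [set P' | exists L P, [/\ Q0 L, pluecker_point L P & projects_to P P']].

Definition bifocal_variety : set (projective bifocal_dim) :=
  zariski_closure projected_Q0.

(* The pair (H1, H2) acts on V1 (+) V2 by diag(H1, H2), hence on the exterior
   power by the matrix of minors of diag(H1, H2), which preserves the bidegree.
   By the Cauchy-Binet formula this is the action that
   [M1|M2] |-> [M1 H1|M2 H2] induces on projected Pluecker coordinates. *)
Definition bifocal_matrix (g : @matrix_pair K h1.+1 h2.+1) :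
    'M[K]_bifocal_dim :=
  \matrix_(i, j) \det (mxsub (val (val (enum_val i : bifocal_index)))
                             (val (val (enum_val j : bifocal_index)))
                             (block_mx g.1 0 0 g.2)).

Definition bifocal_act (P : projective bifocal_dim)
    (g : matrix_pair h1.+1 h2.+1) : projective bifocal_dim :=
  linear_act (bifocal_matrix g) P.

End BifocalGrassmannTensors.

(* Main.v *)
Require Import Defs.
From HB Require Import structures.
From mathcomp Require Import all_boot all_order all_algebra all_fingroup closed_field.
From mathcomp Require Import classical_sets boolp reals complex mpoly.
Set Implicit Arguments.
Unset Strict Implicit.
Unset Printing Implicit Defensive.
Import GRing.Theory.
Local Open Scope ring_scope.
Local Open Scope classical_set_scope.

(** The set of pairs [M1|M2] considered here is, up to the left action of
    GL(k+1), a single orbit of GL(h1+1) x GL(h2+1): the left kernels of M1 and M2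
    are two subspaces of K^(k+1) of prescribed dimensions meeting in 0, any two such configurations differ by a change of basis of
    K^(k+1), and matrices of full column rank with the same left kernel have the
    same column space ([W0_equiv]). The left action of GL(k+1) multiplies the
    Pluecker coordinates by a determinant, and by the Cauchy-Binet formula the
    right action of a block diagonal matrix diag(H1, H2) acts on the coordinates
    of bidegree (a1, a2) by a matrix of minors, without mixing in the other
    bidegrees ([bidegree_part_diag_pair]). Hence the projection Y of the open set
    is one orbit of lines for this linear representation
    ([projected_Q0_orbit]); it is nonempty because some pair [M1|M2] has the
    identity matrix as a minor of bidegree (a1, a2) ([witness_neq0]).

    It remains to see that Y is open in its closure X, for then the identity of Y
    is a birational equivalence between X and the homogeneous space Y, and it is
    equivariant. This is the general fact that orbits are locally closed,
    obtained as follows. The cone over Y is the image of a basic open set of an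
    affine space under a polynomial map. By quantifier elimination over an
    algebraically closed field it is constructible ([constructible_image]); it is
    irreducible because any two points of the basic open set lie on a line that
    meets it in a dense subset ([affine_irreducible_image]). An irreducible
    constructible set contains a nonempty open subset of its closure
    ([constructible_contains_open]), and the translates of this open subset cover
    the orbit ([orbit_open_in_closure]). Homogeneity of the vanishing ideal of a
    cone transfers the statement to projective space
    ([open_in_closure_of_cone]). *)

(** * Polynomial functions *)

Section PolynomialFunctions.
Variable K : fieldType.

Definition polyfun n (f : 'rV[K]_n -> K) :=
  exists p : {mpoly K[n]}, forall x, f x = p.@[x 0].

Lemma polyfun_ext n (f g : 'rV[K]_n -> K) :
  f =1 g -> polyfun f -> polyfun g.
Proof. by move=> fg [p fp]; exists p => x; rewrite -fg. Qed.

Lemma polyfun_mpoly n (p : {mpoly K[n]}) : polyfun (fun x => p.@[x 0]).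
Proof. by exists p. Qed.

Lemma polyfun_const n (c : K) : polyfun (fun _ : 'rV[K]_n => c).
Proof. by exists c%:MP => x; rewrite mevalC. Qed.

Lemma polyfun_coord n (i : 'I_n) : polyfun (fun x : 'rV[K]_n => x 0 i).
Proof. by exists 'X_i => x; rewrite mevalXU. Qed.

Lemma polyfunD n (f g : 'rV[K]_n -> K) :
  polyfun f -> polyfun g -> polyfun (fun x => f x + g x).
Proof.
by move=> [p fp] [q gq]; exists (p + q) => x; rewrite mevalD fp gq.
Qed.

Lemma polyfunM n (f g : 'rV[K]_n -> K) :
  polyfun f -> polyfun g -> polyfun (fun x => f x * g x).
Proof.
by move=> [p fp] [q gq]; exists (p * q) => x; rewrite mevalM fp gq.
Qed.

Lemma polyfun_sum n I (r : seq I) (F : I -> 'rV[K]_n -> K) :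
  (forall i, polyfun (F i)) -> polyfun (fun x => \sum_(i <- r) F i x).
Proof.
move=> pF; elim: r => [|i r IH].
  by apply: polyfun_ext (polyfun_const _ 0) => x; rewrite big_nil.
by apply: polyfun_ext (polyfunD (pF i) IH) => x; rewrite big_cons.
Qed.

Lemma polyfun_prod n I (r : seq I) (F : I -> 'rV[K]_n -> K) :
  (forall i, polyfun (F i)) -> polyfun (fun x => \prod_(i <- r) F i x).
Proof.
move=> pF; elim: r => [|i r IH].
  by apply: polyfun_ext (polyfun_const _ 1) => x; rewrite big_nil.
by apply: polyfun_ext (polyfunM (pF i) IH) => x; rewrite big_cons.
Qed.

Lemma polyfun_det n k (M : 'rV[K]_n -> 'M[K]_k) :
  (forall i j, polyfun (fun x => M x i j)) -> polyfun (fun x => \det (M x)).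
Proof.
move=> pM; apply: polyfun_sum => s.
by apply: polyfunM (polyfun_const _ _) (polyfun_prod _ _) => i; apply: pM.
Qed.

Lemma polyfun_comp n m (f : 'rV[K]_n -> K) (phi : 'rV[K]_m -> 'rV[K]_n) :
  polyfun f -> (forall j, polyfun (fun y => phi y 0 j)) ->
  polyfun (fun y => f (phi y)).
Proof.
move=> [p fp] /fin_all_exists[q phiq].
exists (p \mPo [tuple q i | i < n]) => y; rewrite fp comp_mpoly_meval.
by apply: meval_eq => i; rewrite tnth_mktuple phiq.
Qed.

(** Restricting to a line turns questions about polynomials in many variables
    into questions about roots of univariate ones. *)
Lemma polyfun_line n (f : 'rV[K]_n -> K) (y0 y1 : 'rV[K]_n) :
  polyfun f -> exists u : {poly K}, forall t, u.[t] = f (y0 + t *: (y1 - y0)).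
Proof.
move=> [p fp]; pose l i := (y0 0 i)%:P + (y1 0 i - y0 0 i)%:P * 'X.
exists (\sum_(m <- msupp p) (p@_m)%:P * \prod_i l i ^+ m i) => t.
rewrite fp mevalE horner_sum; apply: eq_bigr => m _.
rewrite hornerM hornerC horner_prod; congr (_ * _); apply: eq_bigr => i _.
by rewrite horner_exp /l !(hornerE, mxE) [t * _]mulrC.
Qed.

End PolynomialFunctions.

(** * Constructible sets and quantifier elimination *)

Section Constructible.
Variable K : closedFieldType.

Local Notation tm := (GRing.term K).

(** A finite union of locally closed sets, each given by the polynomials that
    must vanish and the polynomials that must not. *)
Definition constructible n (C : set 'rV[K]_n) :=
  exists s : seq (seq {mpoly K[n]} * seq {mpoly K[n]}), forall x : 'rV[K]_n,
    C x <-> has (fun c => all (fun p => p.@[x 0] == 0) c.1 &&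
                          all (fun p => p.@[x 0] != 0) c.2) s.

(** The offset lets the coordinates of a parameter be numbered after those of
    the point that depends on it. *)
Definition term_of_mpoly off n (p : {mpoly K[n]}) : tm :=
  \big[GRing.Add/0%T]_(m <- msupp p)
    (GRing.Const (p@_m) * \big[GRing.Mul/1%T]_(i < n) 'X_(off + i) ^+ m i)%T.

Lemma rterm_term_of_mpoly off n (p : {mpoly K[n]}) :
  GRing.rterm (term_of_mpoly off p).
Proof.
rewrite /term_of_mpoly; apply: (@big_ind tm (@GRing.rterm K))
  => // [s t /= -> -> //|m _ /=].
by apply: (@big_ind tm (@GRing.rterm K)) => // s t /= -> ->.
Qed.

Lemma eval_term_of_mpoly off n (p : {mpoly K[n]}) (e : seq K) :
  GRing.eval e (term_of_mpoly off p) = p.@[fun i => e`_(off + i)].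
Proof.
rewrite mevalE /term_of_mpoly (big_morph (GRing.eval e) (id1 := 0) (op1 := +%R)) //.
apply: eq_bigr => m _ /=; congr (_ * _).
by rewrite (big_morph (GRing.eval e) (id1 := 1) (op1 := *%R)).
Qed.

(** Inverses are sent to an arbitrary value, as they do not occur in the terms
    of the language of rings. *)
Fixpoint mpoly_of_term n (t : tm) : {mpoly K[n]} :=
  match t with
  | GRing.Var i => if insub i is Some j then 'X_(j : 'I_n) else 0
  | GRing.Const c => c%:MP
  | GRing.NatConst k => k%:R
  | GRing.Add t1 t2 => mpoly_of_term n t1 + mpoly_of_term n t2
  | GRing.Opp t1 => - mpoly_of_term n t1
  | GRing.NatMul t1 k => mpoly_of_term n t1 *+ k
  | GRing.Mul t1 t2 => mpoly_of_term n t1 * mpoly_of_term n t2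
  | GRing.Inv t1 => 0
  | GRing.Exp t1 k => mpoly_of_term n t1 ^+ k
  end.

Definition env n (x : 'rV[K]_n) : seq K := [seq x 0 i | i <- enum 'I_n].

Lemma size_env n (x : 'rV[K]_n) : size (env x) = n.
Proof. by rewrite size_map size_enum_ord. Qed.

Lemma nth_env n (x : 'rV[K]_n) (i : 'I_n) : (env x)`_i = x 0 i.
Proof. by rewrite (nth_map i) ?size_enum_ord // nth_ord_enum. Qed.

Lemma eval_mpoly_of_term n (t : tm) (x : 'rV[K]_n) :
  GRing.rterm t -> (mpoly_of_term n t).@[x 0] = GRing.eval (env x) t.
Proof.
elim: t => //=.
- move=> i _; case: insubP => [j _ <-|]; first by rewrite mevalXU nth_env.
  by rewrite -leqNgt => le_ni; rewrite meval0 nth_default ?size_env.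
- by move=> c _; rewrite mevalC.
- by move=> k _; rewrite rmorph_nat.
- by move=> t1 IH1 t2 IH2 /andP[/IH1 <- /IH2 <-]; rewrite mevalD.
- by move=> t1 IH1 /IH1 <-; rewrite mevalN.
- by move=> t1 IH1 k /IH1 <-; rewrite mevalMn.
- by move=> t1 IH1 t2 IH2 /andP[/IH1 <- /IH2 <-]; rewrite mevalM.
- by move=> t1 IH1 k /IH1 <-; rewrite rmorphXn.
Qed.

Lemma qf_eval_dnf (e : seq K) bcs :
  GRing.qf_eval e (GRing.dnf_to_form bcs) =
  has (fun bc => all (fun t => GRing.eval e t == 0) bc.1 &&
                 all (fun t => GRing.eval e t != 0) bc.2) bcs.
Proof.
elim: bcs => //= -[ps qs] bcs <- /=; congr (_ && _ || _).
  by elim: ps => //= t ps ->.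
by elim: qs => //= t qs ->.
Qed.

Lemma holds_foldr_and (e : seq K) I (r : seq I) (F : I -> GRing.formula K) :
  GRing.holds e (foldr (fun i f => F i /\ f)%T GRing.True%T r) <->
  (forall k, (k < size r)%N -> GRing.holds e (nth GRing.True%T (map F r) k)).
Proof.
elim: r => [|i r IH] //=; split=> [[Fi /IH Fr] [|k] //= /Fr //|F_r].
by split; [exact: (F_r 0%N) | apply/IH => k; exact: (F_r k.+1)].
Qed.

(** Quantifier elimination replaces the formula by a quantifier-free one, whose
    disjunctive normal form is a list of systems of equations and inequations. *)
Lemma constructible_formula n (C : set 'rV[K]_n) (f : GRing.formula K) :
  GRing.rformula f -> (forall x, C x <-> GRing.holds (env x) f) ->
  constructible C.
Proof.
move=> rf Cf; pose qe := GRing.quantifier_elim (@ClosedFieldQE.ex_elim K) f.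
have qeP e : reflect (GRing.holds e f) (GRing.qf_eval e qe).
  apply: GRing.quantifier_elim_rformP rf; first exact: ClosedFieldQE.wf_ex_elim.
  exact: ClosedFieldQE.holds_ex_elim (@solve_monicpoly K).
have qf_qe : GRing.qf_form qe && GRing.rformula qe.
  by apply: GRing.quantifier_elim_wf => //; apply: ClosedFieldQE.wf_ex_elim.
have /andP[_ r_qe] := qf_qe.
have := GRing.qf_to_dnf_rterm false r_qe.
set bcs := GRing.qf_to_dnf qe false => rbcs.
exists [seq (map (mpoly_of_term n) bc.1, map (mpoly_of_term n) bc.2) | bc <- bcs].
move=> x; rewrite (_ : C x <-> GRing.qf_eval (env x) qe); last first.
  by rewrite Cf; split=> /qeP.
rewrite -(GRing.qf_to_dnfP _ qf_qe) qf_eval_dnf -/bcs has_map.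
set l := has _ _; set r := has _ _; suff -> : l = r by [].
rewrite {}/l {}/r; elim: bcs rbcs => //= -[ps qs] bcs IH /andP[/andP[/= rps rqs] /IH->].
congr (_ && _ || _); rewrite all_map.
  by elim: ps rps => //= t ps IHps /andP[rt /IHps->]; rewrite eval_mpoly_of_term.
by elim: qs rqs => //= t qs IHqs /andP[rt /IHqs->]; rewrite eval_mpoly_of_term.
Qed.

(** Chevalley's theorem for a basic open set: being in the image is expressed by
    a first-order formula with one quantifier per coordinate of the source. *)
Lemma constructible_image n m (D : 'rV[K]_m -> K) (F : 'rV[K]_m -> 'rV[K]_n) :
  polyfun D -> (forall j, polyfun (fun y => F y 0 j)) ->
  constructible [set x | exists2 y, D y != 0 & x = F y].
Proof.
move=> [d Dd] /fin_all_exists[p Fp].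
pose eqF (j : 'I_n) := ('X_j == term_of_mpoly n (p j))%T.
pose body := (~ (term_of_mpoly n d == 0) /\
  foldr (fun j f => eqF j /\ f) GRing.True (enum 'I_n))%T.
have bodyP e : GRing.holds e body <->
    d.@[fun i => e`_(n + i)] != 0 /\
    forall j : 'I_n, e`_j = (p j).@[fun i => e`_(n + i)].
  rewrite /body /= holds_foldr_and eval_term_of_mpoly; split=> -[/eqP d0 eF];
    (split; first by []).
    move=> j; have := eF j; rewrite size_enum_ord (nth_map j) ?size_enum_ord //.
    by rewrite nth_ord_enum /= eval_term_of_mpoly; apply.
  move=> k; rewrite size_enum_ord => lt_kn; pose j := Ordinal lt_kn.
  rewrite (nth_map j) ?size_enum_ord // -[k]/(val j) nth_ord_enum /=.
  by rewrite eval_term_of_mpoly; apply: (eF j).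
apply: (@constructible_formula _ _ (foldr GRing.Exists body (iota n m))) => [|x].
  suff: GRing.rformula body by elim: (iota n m).
  rewrite /body /= rterm_term_of_mpoly /=.
  by elim: (enum 'I_n) => //= j r ->; rewrite rterm_term_of_mpoly.
split=> [[y Dy ->] | ].
  apply/GRing.foldExistsP; exists (env (F y) ++ env y).
    move=> k; rewrite !inE mem_iota nth_cat size_env; case: (ltnP k n) => //= le_nk.
    rewrite -leqNgt => le_mk.
    by rewrite !nth_default ?size_env // leq_subRL.
  apply/bodyP; rewrite -(_ : y 0 =
      (fun i : 'I_m => (env (F y) ++ env y)`_(n + i))); last first.
    apply/funext => i.
    by rewrite nth_cat size_env ltnNge leq_addr /= addKn nth_env.
  rewrite -Dd; split=> // j.
  by rewrite nth_cat size_env ltn_ord nth_env Fp.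
case/GRing.foldExistsP => e ee /bodyP[d0 eF].
pose y : 'rV[K]_m := \row_i e`_(n + i).
have ye : (fun i : 'I_m => e`_(n + i)) =1 y 0 by move=> i; rewrite mxE.
exists y; first by rewrite Dd -(meval_eq _ ye).
apply/rowP => j; rewrite Fp -(meval_eq _ ye) -eF.
rewrite -nth_env; apply: ee; rewrite !inE mem_iota negb_and.
by rewrite -ltnNge ltn_ord.
Qed.

End Constructible.

(** * Orbits are open in their closure: the affine case *)

Section AffineZariski.
Variable K : closedFieldType.
Variable n : nat.
Implicit Types (C A : set 'rV[K]_n) (x y : 'rV[K]_n) (p q : {mpoly K[n]}).

Definition vanishes_on C p := forall x, C x -> p.@[x 0] = 0.

Definition affine_closed A :=
  exists S : set {mpoly K[n]}, A = [set x | forall p, S p -> p.@[x 0] = 0].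

Definition affine_closure C : set 'rV[K]_n :=
  [set x | forall p, vanishes_on C p -> p.@[x 0] = 0].

Definition affine_irreducible C :=
  C !=set0 /\ forall p q, vanishes_on C (p * q) ->
    vanishes_on C p \/ vanishes_on C q.

Lemma sub_affine_closure C : C `<=` affine_closure C.
Proof. by move=> x Cx p; apply. Qed.

Lemma mevalM_row p (A : 'M[K]_n) : exists q : {mpoly K[n]},
  forall x, q.@[x 0] = p.@[(x *m A) 0].
Proof.
have : polyfun (fun x => p.@[(x *m A) 0]).
  apply: (polyfun_comp (polyfun_mpoly p)) => j.
  apply: polyfun_ext (polyfun_sum (index_enum _)
    (fun i => polyfunM (polyfun_coord _ i) (polyfun_const _ (A i j)))) => x.
  by rewrite mxE.
by case=> q pq; exists q => x; rewrite pq.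
Qed.

Lemma affine_closure_stable C (A : 'M[K]_n) :
  (forall x, C x -> C (x *m A)) ->
  forall x, affine_closure C x -> affine_closure C (x *m A).
Proof.
move=> CA x clx p Cp; have [q qp] := mevalM_row p A.
by rewrite -qp; apply: clx => y /CA/Cp; rewrite qp.
Qed.

Lemma vanishes_on_big_prod C (s : seq {mpoly K[n]}) : affine_irreducible C ->
  vanishes_on C (\prod_(p <- s) p) -> exists2 p, p \in s & vanishes_on C p.
Proof.
move=> [[x0 Cx0] irr]; elim: s => [|p s IH].
  by rewrite big_nil => /(_ _ Cx0); rewrite meval1 => /eqP; rewrite oner_eq0.
rewrite big_cons => /irr[Cp|/IH[q qs Cq]]; first by exists p; rewrite ?mem_head.
by exists q => //; rewrite inE qs orbT.
Qed.

(** Of the finitely many locally closed pieces of [C] one must be dense, by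
    irreducibility, and a dense locally closed set is open in its closure. *)
Lemma constructible_contains_open C : constructible C -> affine_irreducible C ->
  exists2 q, ~ vanishes_on C q &
    forall x, affine_closure C x -> q.@[x 0] != 0 -> C x.
Proof.
move=> [s Cs] irrC.
(* The piece [c] is good if it is dense in [C]. *)
pose good (c : seq {mpoly K[n]} * seq {mpoly K[n]}) :=
  (forall p, p \in c.1 -> vanishes_on C p) /\
  ~ vanishes_on C (\prod_(q <- c.2) q).
have prod_neq0 (c : seq {mpoly K[n]} * seq {mpoly K[n]}) x :
    ((\prod_(q <- c.2) q).@[x 0] != 0) = all (fun p => p.@[x 0] != 0) c.2.
  by rewrite rmorph_prod prodf_seq_neq0.
have [[c cs [c1 c2]]|ngood] := pselect (exists2 c, c \in s & good c).
  exists (\prod_(q <- c.2) q) => // x clx; rewrite prod_neq0 => c2x.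
  apply/Cs/hasP; exists c => //; rewrite c2x andbT.
  by apply/allP => p /c1/clx ->.
(* Otherwise every piece lies in a hypersurface not containing [C], and the
   union of these hypersurfaces contains [C]. *)
have bad c : exists r : {mpoly K[n]}, c \in s -> ~ vanishes_on C r /\
    forall x, all (fun p => p.@[x 0] == 0) c.1 &&
              all (fun p => p.@[x 0] != 0) c.2 -> C x -> r.@[x 0] = 0.
  have [[p pc Cp]|np] := pselect (exists2 p, p \in c.1 & ~ vanishes_on C p).
    exists p => _; split=> // x /andP[/allP c1 _] _; exact/eqP/c1.
  have Cc1 p : p \in c.1 -> vanishes_on C p.
    by move=> pc; have [//|Cp] := pselect (vanishes_on C p); case: np; exists p.
  exists 1 => cs; split=> [C1|x /andP[_]].
    by case: irrC => -[x Cx] _; have /eqP := C1 x Cx; rewrite meval1 oner_eq0.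
  rewrite -prod_neq0 => c2x Cx; case: ngood; exists c => //; split=> //.
  by move/(_ x Cx)/eqP; apply/negP.
have [r rP] := boolp.choice bad.
have /(vanishes_on_big_prod irrC)[p /mapP[c cs ->] Cp] :
    vanishes_on C (\prod_(p <- map r s) p).
  move=> x Cx; have /Cs/hasP[c cs cx] := Cx.
  apply/eqP; rewrite rmorph_prod prodf_seq_eq0; apply/hasP; exists (r c).
    exact: map_f.
  by rewrite /=; apply/eqP; case: (rP c cs) => _; apply.
by case: (rP c cs).
Qed.

(** The matrices in [T] preserve both [C] and its complement and act transitively
    on [C]. If [q <> 0] cuts out a nonempty open subset of the closure contained
    in [C], the complement of [C] in its closure is where all the translates of
    [q] vanish. *)
Lemma orbit_open_in_closure C (T : set 'M[K]_n) :
  constructible C -> affine_irreducible C ->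
  (forall (A : 'M[K]_n) x, T A -> C x <-> C (x *m A)) ->
  (forall x y, C x -> C y -> exists2 A, T A & y = x *m A) ->
  affine_closed (affine_closure C `\` C).
Proof.
move=> consC irrC stabC transC.
have [q qC0 qC] := constructible_contains_open consC irrC.
pose S : set {mpoly K[n]} := [set p | vanishes_on C p \/
  exists2 A, T A & forall x, p.@[x 0] = q.@[(x *m A) 0]].
exists S; apply/seteqP; split=> [x [clx nCx] p [/clx //|[A TA ->]]|x Sx].
  apply/eqP/contraT => qxA; case: nCx; apply/(stabC A) => //.
  by apply: qC qxA; apply: affine_closure_stable clx => y; apply stabC.
split=> [p Cp|Cx]; first by apply: Sx; left.
have [y Cy qy] : exists2 y, C y & q.@[y 0] <> 0.
  apply: contrapT => ny; apply: qC0 => y Cy; apply: contrapT => qy.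
  by apply: ny; exists y.
apply: qy; have [A TA ->] := transC x y Cx Cy.
have [p pq] := mevalM_row q A.
by rewrite -pq; apply: Sx; right; exists A.
Qed.

End AffineZariski.

Section IrreducibleImage.
Variable K : closedFieldType.

(** A basic open set of an affine space is irreducible, as any two of its points
    lie on a line, most of which it contains; so is its image. *)
Lemma affine_irreducible_image n m (D : 'rV[K]_m -> K)
    (F : 'rV[K]_m -> 'rV[K]_n) :
  polyfun D -> (forall j, polyfun (fun y => F y 0 j)) ->
  (exists y, D y != 0) ->
  affine_irreducible [set x | exists2 y, D y != 0 & x = F y].
Proof.
move=> pD pF [z Dz]; split=> [|p q Cpq]; first by exists (F z), z.
set C := [set x | _].
have [Cp|/existsNP[x /not_implyP[[y0 Dy0 ->] /eqP px]]] := pselect (vanishes_on C p).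
  by left.
right=> _ [y1 Dy1 ->]; apply/eqP/contraT => qx.
have pol (r : {mpoly K[n]}) : polyfun (fun y => r.@[F y 0]).
  exact: polyfun_comp (polyfun_mpoly r) pF.
have [uD uDE] := polyfun_line y0 y1 pD.
have [up upE] := polyfun_line y0 y1 (pol p).
have [uq uqE] := polyfun_line y0 y1 (pol q).
have at0 : y0 + 0 *: (y1 - y0) = y0 by rewrite scale0r addr0.
have at1 : y0 + 1 *: (y1 - y0) = y1 by rewrite scale1r addrC subrK.
have : uD * up * uq != 0.
  rewrite !mulf_neq0 //.
  - by apply: contraNneq Dy0 => u0; rewrite -at0 -uDE u0 horner0.
  - by apply: contraNneq px => u0; rewrite -at0 -upE u0 horner0.
  by apply: contraNneq qx => u0; rewrite -at1 -uqE u0 horner0.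
case/closed_nonrootP => t; rewrite !rootM !negb_or -andbA /root uDE upE uqE.
set y := y0 + _ => /and3P[Dy py qy].
have /eqP := Cpq (F y) (ex_intro2 _ _ y Dy erefl).
by rewrite mevalM mulf_eq0 (negPf py) (negPf qy).
Qed.

End IrreducibleImage.

(** * From affine cones to projective varieties *)

Section Lines.
Variables (K : fieldType) (n : nat).
Implicit Types (P Q : @projective K n) (x y : 'rV[K]_n).

Lemma line_eq P x : x \in val P -> x != 0 -> val P = <[x]>%VS.
Proof.
move=> Px x0; apply/esym/eqP; rewrite eqEdim -memvE Px /= dim_vline x0.
by rewrite (eqP (valP P)).
Qed.

Lemma line_generator P : exists2 x, x != 0 & val P = <[x]>%VS.
Proof.
exists (vpick (val P)); last apply: line_eq (memv_pick _) _.
all: by rewrite vpick0 -dimv_eq0 (eqP (valP P)).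
Qed.

Definition line_of x (x0 : x != 0) : @projective K n :=
  exist _ <[x]>%VS (introT eqP (etrans (dim_vline x) (congr1 nat_of_bool x0))).

End Lines.

Section ProjectiveZariski.
Variables (K : closedFieldType) (n : nat).
Implicit Types (P Q : @projective K n) (x y : 'rV[K]_n).
Implicit Types (X Y Z : set (@projective K n)) (p q : {mpoly K[n]}).

Lemma dhomog_scale d p (c : K) x :
  p \is d.-homog -> p.@[(c *: x) 0] = c ^+ d * p.@[x 0].
Proof.
move=> /dhomogP pd; rewrite !mevalE mulr_sumr; apply: eq_big_seq => m /pd <-.
rewrite mulrCA; congr (_ * _); rewrite /= mdegE -prodrXr -big_split /=.
by apply: eq_bigr => i _; rewrite mxE exprMn.
Qed.

Lemma vanishesE d p P x : p \is d.-homog -> x \in val P -> x != 0 ->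
  vanishes p P <-> p.@[x 0] = 0.
Proof.
move=> pd Px x0; split=> [|px y]; first exact.
rewrite (line_eq Px x0) => /vlineP[c ->].
by rewrite (dhomog_scale _ _ pd) px mulr0.
Qed.

Lemma zariski_closureE X : zariski_closure X =
  [set P | forall p, (exists d, p \is d.-homog) ->
                     (forall Q, X Q -> vanishes p Q) -> vanishes p P].
Proof.
apply/seteqP; split=> [P clP p [d pd] Xp|P XP Z [[S Sh ->] XZ] p Sp]; last first.
  by apply: XP => [|Q /XZ]; [exact: Sh | apply].
apply: (clP [set Q | forall q, q = p -> vanishes q Q]) => //; split.
  by exists [set p] => // q ->; exists d.
by move=> Q XQ q ->; apply: Xp.
Qed.

Lemma zariski_closed_closure X : zariski_closed (zariski_closure X).
Proof.
exists [set p | (exists d, p \is d.-homog) /\ forall Q, X Q -> vanishes p Q].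
  by move=> p [].
rewrite zariski_closureE; apply/seteqP; split=> [P clP p []|P clP p p1 p2].
  exact: clP.
exact: clP.
Qed.

Lemma sub_zariski_closure X : X `<=` zariski_closure X.
Proof. by move=> P XP Z [_]; apply. Qed.

Lemma zariski_closure_sub X Z :
  zariski_closed Z -> X `<=` Z -> zariski_closure X `<=` Z.
Proof. by move=> Zc XZ P; apply. Qed.

Lemma zariski_closed0 : zariski_closed (set0 : set (@projective K n)).
Proof.
exists [set 1]; first by move=> p ->; exists 0%N; apply: dhomog1.
apply/seteqP; split=> // P /(_ 1 erefl)/(_ 0 (mem0v _)) /eqP.
by rewrite meval1 oner_eq0.
Qed.

Lemma open_in_refl X : open_in X X.
Proof. by exists set0; [exact: zariski_closed0 | rewrite setD0]. Qed.

(** Over an infinite field, the homogeneous components of a polynomial vanishing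
    on a cone vanish on it as well. *)
Lemma vanishes_on_pihomog (A : set 'rV[K]_n) p d :
  (forall c x, c != 0 -> A x -> A (c *: x)) ->
  vanishes_on A p -> vanishes_on A (pihomog [measure of mdeg] d p).
Proof.
move=> Ac Ap x Ax; pose k := maxn (msize p) d.+1.
pose u := \poly_(e < k) (pihomog [measure of mdeg] e p).@[x 0].
have uE t : u.[t] = p.@[(t *: x) 0].
  rewrite [in RHS](pihomog_partitionE (leq_maxl _ d.+1 : mmeasure mdeg p <= k)%N).
  rewrite horner_poly raddf_sum; apply: eq_bigr => e _ /=.
  by rewrite (dhomog_scale _ _ (pihomogP _ _ _)) mulrC.
have u0 : 'X * u = 0.
  apply/eqP/contraT => /closed_nonrootP[t]; rewrite rootM negb_or rootX /root uE.
  by case/andP=> t0; rewrite Ap ?eqxx //; apply: Ac.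
have /(congr1 (fun q : {poly K} => q`_d.+1)) := u0.
by rewrite coefXM coef0 /= coef_poly leq_maxr.
Qed.

Definition projectivization (A : set 'rV[K]_n) : set (@projective K n) :=
  [set P : @projective K n | forall x, x \in val P -> x != 0 -> A x].

(** The defining polynomials of a cone may be replaced by their homogeneous
    components, which vanish on it too. *)
Lemma zariski_closed_projectivization (A : set 'rV[K]_n) :
  (forall c x, c != 0 -> A x -> A (c *: x)) ->
  affine_closed A -> zariski_closed (projectivization A).
Proof.
move=> Ac [S AE]; exists [set p | (exists d, p \is d.-homog) /\
                             forall x, x != 0 -> A x -> p.@[x 0] = 0].
  by move=> p [].
apply/seteqP; split=> [P AP p [[d pd] Ap]|P SP x Px x0].
  have [x x0 Px] := line_generator P; have xP : x \in val P by rewrite Px memv_line.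
  by apply/(vanishesE pd xP x0)/Ap => //; apply: AP.
rewrite AE => p Sp.
have /(congr1 (meval (x 0))) -> :=
  pihomog_partitionE (leqnn (mmeasure [measure of mdeg] p)).
rewrite raddf_sum big1 //= => d _.
apply: SP Px; split; first by exists d; apply: pihomogP.
by move=> y _; apply: vanishes_on_pihomog => // z; rewrite AE; apply.
Qed.

(** The vertex 0 is left unconstrained. *)
Definition cone_over (C : set 'rV[K]_n) Y :=
  forall P x, x \in val P -> x != 0 -> C x <-> Y P.

Variables (C : set 'rV[K]_n) (Y : set (@projective K n)).
Hypotheses (C0 : forall x, C x -> x != 0) (CY : cone_over C Y).

Lemma cone_over_scale c x : c != 0 -> C x -> C (c *: x).
Proof.
move=> c0 Cx; have x0 := C0 Cx.
apply/(CY (P := line_of x0)); first by rewrite memvZ ?memv_line.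
  by rewrite scaler_eq0 negb_or c0.
by apply/(CY _ x0) => //; apply: memv_line.
Qed.

(** The closure of the cone is a cone, and its projectivization contains the
    closure of [Y]. *)
Lemma open_in_closure_of_cone :
  affine_closed (affine_closure C `\` C) -> open_in (zariski_closure Y) Y.
Proof.
have scale_cl c x : c != 0 -> affine_closure C x -> affine_closure C (c *: x).
  move=> c0; rewrite -mul_mx_scalar; apply: affine_closure_stable => y.
  by rewrite mul_mx_scalar; apply: cone_over_scale.
move=> clC; exists (projectivization (affine_closure C `\` C)).
  apply: zariski_closed_projectivization => // c x c0 [clx nCx].
  split; first exact: scale_cl.
  move=> /(cone_over_scale (invr_neq0 c0)).
  by rewrite scalerA mulVf // scale1r.
have clY : zariski_closure Y `<=` projectivization (affine_closure C).
  apply: zariski_closure_sub => [|P YP x Px x0].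
    apply: zariski_closed_projectivization => //.
    by exists (vanishes_on C).
  by apply: sub_affine_closure; apply/(CY Px x0).
apply/seteqP; split=> [P YP|P [clP nP]].
  split; first exact: sub_zariski_closure.
  have [x x0 Px] := line_generator P; have xP : x \in val P by rewrite Px memv_line.
  by move=> /(_ _ xP x0)[_]; apply; apply/(CY xP x0).
have [x [Px x0 nx]] : exists x, [/\ x \in val P, x != 0 &
    ~ (affine_closure C `\` C) x].
  apply: contrapT => nx; apply: nP => x Px x0; apply: contrapT => ncx.
  by apply: nx; exists x.
apply/(CY Px x0); apply: contrapT => nCx; apply: nx; split=> //.
exact: clY clP _ Px x0.
Qed.

Lemma irreducible_of_cone : affine_irreducible C -> irreducible Y.
Proof.
move=> [[x0 Cx0] irrC]; split.
  exists (line_of (C0 Cx0)); apply/(CY _ (C0 Cx0)) => //; exact: memv_line.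
move=> A B [SA SAh AE] [SB SBh BE] YAB.
have [YA|nYA] := pselect (Y `<=` A); [by left | right=> Q YQ].
have [P [YP nAP]] : exists P, Y P /\ ~ A P.
  apply: contrapT => nP; apply: nYA => P YP; apply: contrapT => nA.
  by apply: nP; exists P.
have [p SAp nvp] : exists2 p, SA p & ~ vanishes p P.
  apply: contrapT => np; apply: nAP; rewrite AE => p SAp; apply: contrapT => nv.
  by apply: np; exists p.
rewrite BE => q SBq.
have [[dp pd] [dq qd]] := (SAh _ SAp, SBh _ SBq).
have toC R : Y R -> exists x, [/\ x \in val R, x != 0 & C x].
  move=> YR; have [x xn0 Rx] := line_generator R; exists x.
  have xR : x \in val R by rewrite Rx memv_line.
  by split=> //; apply/(CY xR xn0).
have [x [Px xn0 Cx]] := toC _ YP; have [y [Qy yn0 Cy]] := toC _ YQ.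
apply/(vanishesE qd Qy yn0).
have [z Cz|Cp|Cq] := irrC p q; last exact: Cq.
  have zn0 := C0 Cz; have zP : z \in val (line_of zn0) by exact: memv_line.
  have YR : Y (line_of zn0) by apply/(CY zP zn0).
  rewrite mevalM; case: (YAB _ YR) => [|].
    by rewrite AE => /(_ _ SAp)/(vanishesE pd zP zn0) ->; rewrite mul0r.
  by rewrite BE => /(_ _ SBq)/(vanishesE qd zP zn0) ->; rewrite mulr0.
by case: nvp; apply/(vanishesE pd Px xn0)/Cp.
Qed.

Lemma irreducible_closure X : irreducible X -> irreducible (zariski_closure X).
Proof.
move=> [[P XP] irr]; split=> [|A B Ac Bc XAB].
  by exists P; apply: sub_zariski_closure.
have /(irr A B Ac Bc)[XA|XB] : X `<=` A `|` B.
- by move=> Q XQ; apply: XAB; apply: sub_zariski_closure.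
- by left; apply: zariski_closure_sub.
by right; apply: zariski_closure_sub.
Qed.

End ProjectiveZariski.

Section BirationalToOpen.
Variables (K : closedFieldType) (n : nat).
Implicit Types X Y : set (@projective K n).

Lemma morphism_on_id X : morphism_on X X id.
Proof.
split=> // P _; exists 1%N, (fun j => 'X_j); split.
- by move=> j; rewrite dhomogX /= mdeg1.
- have [x x0 Px] := line_generator P; exists x; first by rewrite Px memv_line.
  by rewrite (_ : poly_map _ x = x) //; apply/rowP => j; rewrite mxE mevalXU.
move=> Q x _; rewrite (_ : poly_map _ x = x); first exact: line_eq.
by apply/rowP => j; rewrite mxE mevalXU.
Qed.

Lemma variety_open_in_closure Y : irreducible Y ->
  open_in (zariski_closure Y) Y ->
  variety Y /\ variety (zariski_closure Y).
Proof.
move=> irrY openY; split; split=> //.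
- by exists (zariski_closure Y) => //; apply: zariski_closed_closure.
- exists (zariski_closure Y); first exact: zariski_closed_closure.
  exact: open_in_refl.
exact: irreducible_closure.
Qed.

(** The identity of [Y] represents both rational maps. *)
Lemma birational_closure Y : irreducible Y -> open_in (zariski_closure Y) Y ->
  birational_equivalence (zariski_closure Y) Y Y id Y id.
Proof.
move=> irrY openY; have [varY varX] := variety_open_in_closure irrY openY.
have [Y0 _] := irrY.
split=> //; split=> //; rewrite ?image_id //.
- exact: morphism_on_id.
- exact: sub_zariski_closure.
- exact: open_in_refl.
by have [_ idP] := morphism_on_id Y; split=> // P; apply: sub_zariski_closure.
Qed.

End BirationalToOpen.

(** * Orbits of lines under a polynomial representation *)

Section LinearAction.
Variables (K : fieldType) (n : nat).
Implicit Types (P : @projective K n) (x : 'rV[K]_n) (A : 'M[K]_n).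

Lemma mulmx_unit_neq0 x A : A \in unitmx -> x != 0 -> x *m A != 0.
Proof.
by move=> Au; apply: contraNneq => xA; rewrite -(mulmxK Au x) xA mul0mx.
Qed.

Lemma val_linear_act A P x : A \in unitmx -> x \in val P -> x != 0 ->
  val (linear_act A P) = <[x *m A]>%VS.
Proof.
move=> Au Px x0; have xA0 := mulmx_unit_neq0 Au x0.
have imgE : (linfun (mulmxr A : 'rV[K]_n -> 'rV[K]_n) @: val P)%VS = <[x *m A]>%VS.
  by rewrite (line_eq Px x0) limg_line lfunE.
by rewrite /linear_act val_insubd imgE dim_vline xA0.
Qed.

End LinearAction.

Section GroupOrbit.
Variables (K : closedFieldType) (n1 n2 m : nat).
Local Notation pair := (@matrix_pair K n1 n2).
Local Notation GL := (@GL_pair K n1 n2).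

Definition pair_of_entries (y : 'rV[K]_(n1 * n1 + n2 * n2)) : pair :=
  (vec_mx (lsubmx y), vec_mx (rsubmx y)).

Lemma entriesK : cancel (@entries K n1 n2) pair_of_entries.
Proof.
by case=> g1 g2; rewrite /pair_of_entries row_mxKl row_mxKr !mxvecK.
Qed.

Lemma polyfun_entry1 i j : polyfun (fun y => (pair_of_entries y).1 i j).
Proof.
apply: polyfun_ext (polyfun_coord _ (lshift _ (mxvec_index i j))) => y.
by rewrite !mxE.
Qed.

Lemma polyfun_entry2 i j : polyfun (fun y => (pair_of_entries y).2 i j).
Proof.
apply: polyfun_ext (polyfun_coord _ (rshift _ (mxvec_index i j))) => y.
by rewrite !mxE.
Qed.

Lemma GL_pair_mul g h : GL g -> GL h -> GL (Defs.mul_pair g h).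
Proof. by move=> [g1 g2] [h1 h2]; split; rewrite unitmx_mul ?g1 ?g2. Qed.

Lemma GL_pair_one : GL (@Defs.one_pair K n1 n2).
Proof. by split; rewrite unitmx1. Qed.

Lemma GL_pair_inv g : GL g ->
  exists2 h, GL h & Defs.mul_pair g h = @Defs.one_pair K n1 n2.
Proof.
move=> [g1 g2]; exists (invmx g.1, invmx g.2); first by split; rewrite unitmx_inv.
by rewrite /Defs.mul_pair /= !mulmxV.
Qed.

Variables (rho : pair -> 'M[K]_m) (v : 'rV[K]_m).
Hypothesis rho_poly : forall i j, polyfun (fun y => rho (pair_of_entries y) i j).
Hypothesis rho_mul : forall g h, rho (Defs.mul_pair g h) = rho g *m rho h.
Hypothesis rho_one : rho (@Defs.one_pair K n1 n2) = 1%:M.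
Hypothesis v0 : v != 0.
Implicit Types (P Q : @projective K m) (x : 'rV[K]_m) (A : 'M[K]_m).

Definition orbit_of_line : set (@projective K m) :=
  [set P | exists2 g, GL g & val P = <[v *m rho g]>%VS].

Definition orbit_act (P : @projective K m) (g : pair) := linear_act (rho g) P.

Local Notation Y := orbit_of_line.

Lemma rho_unit g : GL g -> rho g \in unitmx.
Proof.
case/GL_pair_inv=> h _ gh.
have gh1 : rho g *m rho h = 1%:M by rewrite -rho_mul gh rho_one.
by case: (mulmx1_unit gh1).
Qed.

Lemma v_rho_neq0 g : GL g -> v *m rho g != 0.
Proof. by move=> /rho_unit gu; apply: mulmx_unit_neq0. Qed.

Lemma val_orbit_act P g x : GL g -> x \in val P -> x != 0 ->
  val (orbit_act P g) = <[x *m rho g]>%VS.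
Proof. by move=> /rho_unit; apply: val_linear_act. Qed.

(** The cone over the orbit is the image of a basic open set: the extra first
    coordinate of the parameter space is the scaling factor. *)
Let D (y : 'rV[K]_(1 + (n1 * n1 + n2 * n2))) :=
  y 0 (lshift _ 0) * (\det (pair_of_entries (rsubmx y)).1 *
                      \det (pair_of_entries (rsubmx y)).2).

Let F (y : 'rV[K]_(1 + (n1 * n1 + n2 * n2))) :=
  y 0 (lshift _ 0) *: (v *m rho (pair_of_entries (rsubmx y))).

Let C : set 'rV[K]_m := [set x | exists2 y, D y != 0 & x = F y].

Lemma orbit_coneE x :
  C x <-> exists c g, [/\ c != 0, GL g & x = c *: (v *m rho g)].
Proof.
split=> [[y]|[c [g [c0 [g1 g2] ->]]]].
  rewrite /D !mulf_eq0 !negb_or => /and3P[y0 y1 y2] ->.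
  exists (y 0 (lshift _ 0)), (pair_of_entries (rsubmx y)); split=> //.
  by split; rewrite unitmxE unitfE.
exists (row_mx c%:M (entries g)); rewrite /D /F row_mxEl row_mxKr entriesK mxE //.
by rewrite mulf_neq0 ?mulf_neq0 // -unitfE -unitmxE.
Qed.

Lemma polyfun_rsubmx (f : 'rV[K]_(n1 * n1 + n2 * n2) -> K) :
  polyfun f -> polyfun (fun y : 'rV[K]_(1 + (n1 * n1 + n2 * n2)) => f (rsubmx y)).
Proof.
move=> pf; apply: polyfun_comp pf _ => j.
by apply: polyfun_ext (polyfun_coord _ (rshift 1 j)) => y; rewrite mxE.
Qed.

Lemma polyfun_orbit_domain : polyfun D.
Proof.
have det1 : polyfun (fun y => \det (pair_of_entries y).1).
  by apply: polyfun_det => i j; apply: polyfun_entry1.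
have det2 : polyfun (fun y => \det (pair_of_entries y).2).
  by apply: polyfun_det => i j; apply: polyfun_entry2.
exact: polyfunM (polyfun_coord _ _) (polyfun_rsubmx (polyfunM det1 det2)).
Qed.

Lemma polyfun_orbit_map j : polyfun (fun y => F y 0 j).
Proof.
have pj : polyfun (fun y => (v *m rho (pair_of_entries y)) 0 j).
  apply: polyfun_ext (polyfun_sum (index_enum _)
    (fun i => polyfunM (polyfun_const _ (v 0 i)) (rho_poly i j))) => y.
  by rewrite mxE.
apply: polyfun_ext (polyfunM (polyfun_coord _ (lshift _ 0)) (polyfun_rsubmx pj)).
by move=> y; rewrite /F [RHS]mxE.
Qed.

Lemma affine_irreducible_orbit_cone : affine_irreducible C.
Proof.
apply: affine_irreducible_image.
- exact: polyfun_orbit_domain.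
- exact: polyfun_orbit_map.
have /orbit_coneE[y Dy _] : exists c g, [/\ c != 0, GL g & v = c *: (v *m rho g)].
  exists 1, (@Defs.one_pair K n1 n2); split; first exact: oner_neq0.
    exact: GL_pair_one.
  by rewrite rho_one mulmx1 scale1r.
by exists y.
Qed.

Lemma orbit_cone_neq0 x : C x -> x != 0.
Proof.
by case/orbit_coneE=> c [g [c0 Gg ->]]; rewrite scaler_eq0 negb_or c0 v_rho_neq0.
Qed.

Lemma orbit_coneP : cone_over C Y.
Proof.
move=> P x Px x0; rewrite orbit_coneE; split=> [[c [g [c0 Gg xE]]]|[g Gg PE]].
  exists g => //; apply: line_eq (v_rho_neq0 Gg).
  have -> : v *m rho g = c^-1 *: x by rewrite xE scalerA mulVf // scale1r.
  exact: memvZ.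
move: Px; rewrite PE => /vlineP[c xE]; exists c, g; split=> //.
by apply: contraNneq x0 => c0; rewrite xE c0 scale0r.
Qed.

(** The group acting on the cone consists of the scalings and of the matrices
    [rho g]. *)
Lemma orbit_open : open_in (zariski_closure Y) Y.
Proof.
apply: (open_in_closure_of_cone orbit_cone_neq0 orbit_coneP).
pose T : set 'M[K]_m := [set A | exists c g, [/\ c != 0, GL g & A = c *: rho g]].
have stab A x : T A -> C x -> C (x *m A).
  move=> [c [g [c0 Gg ->]]] /orbit_coneE[d [h [d0 Gh ->]]]; apply/orbit_coneE.
  exists (c * d), (Defs.mul_pair h g).
  split; [by rewrite mulf_neq0 | exact: GL_pair_mul |].
  by rewrite rho_mul mulmxA -scalemxAr -scalemxAl scalerA.
have invT A : T A -> exists2 B, T B & A *m B = 1%:M.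
  move=> [c [g [c0 /GL_pair_inv[h Gh gh] ->]]]; exists (c^-1 *: rho h).
    by exists c^-1, h; split; rewrite ?invr_eq0.
  by rewrite -scalemxAl -scalemxAr scalerA divff // scale1r -rho_mul gh rho_one.
apply: (orbit_open_in_closure (T := T)).
- exact: constructible_image polyfun_orbit_domain polyfun_orbit_map.
- exact: affine_irreducible_orbit_cone.
- move=> A x TA; split; first exact: stab.
  have [B TB AB] := invT A TA.
  by move/(stab B _ TB); rewrite -mulmxA AB mulmx1.
move=> _ _ /orbit_coneE[c [g [c0 Gg ->]]] /orbit_coneE[d [h [d0 Gh ->]]].
have [k Gk gk] := GL_pair_inv Gg.
exists ((d / c) *: rho (Defs.mul_pair k h)).
  exists (d / c), (Defs.mul_pair k h); split=> //; last exact: GL_pair_mul.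
  by rewrite mulf_neq0 ?invr_eq0.
rewrite -scalemxAr -scalemxAl scalerA divfK // rho_mul mulmxA -[v *m _ *m _]mulmxA.
by rewrite -rho_mul gk rho_one mulmx1.
Qed.

Lemma orbit_irreducible : irreducible Y.
Proof.
exact: irreducible_of_cone orbit_cone_neq0 orbit_coneP affine_irreducible_orbit_cone.
Qed.

Lemma algebraic_orbit_act : algebraic_action Y orbit_act.
Proof.
move=> P g YP Gg.
have /fin_all_exists[r rE] : forall i, exists r : 'I_m -> {mpoly K[_]},
    forall j y, rho (pair_of_entries y) i j = (r j).@[y 0].
  by move=> i; apply: (fin_all_exists (rho_poly i)).
(* The action is linear in the point, with coefficients polynomial in the group
   element. *)
pose G j : {mpoly {mpoly K[n1 * n1 + n2 * n2]}[m]} := \sum_i r i j *: 'X_i.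
have GE x h : poly_act G x h = x *m rho h.
  apply/rowP => j; rewrite !mxE /G.
  rewrite (rmorph_sum (map_mpoly (meval (entries h 0)))) (rmorph_sum (meval (x 0))).
  apply: eq_bigr => i _ /=.
  rewrite map_mpolyZ map_mpolyX mevalZ mevalXU mulrC.
  by rewrite -[h in RHS]entriesK rE.
exists 1%N, G; split.
- by move=> j; apply: rpred_sum => i _; apply: rpredZ; rewrite dhomogX /= mdeg1.
- have [x x0 Px] := line_generator P; exists x; first by rewrite Px memv_line.
  by rewrite GE mulmx_unit_neq0 ?rho_unit.
move=> Q h x _ Gh Qx; rewrite GE => xh0; apply: val_orbit_act => //.
by apply: contraNneq xh0 => ->; rewrite mul0mx.
Qed.

Lemma homogeneous_orbit : homogeneous_space Y orbit_act.
Proof.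
have inY P : Y P -> exists2 g, GL g & v *m rho g \in val P.
  by move=> [g Gg PE]; exists g; rewrite // PE memv_line.
split.
- split; last exact: algebraic_orbit_act.
  by have [] := variety_open_in_closure orbit_irreducible orbit_open.
- move=> P h /inY[g Gg Pg] Gh; exists (Defs.mul_pair g h); first exact: GL_pair_mul.
  by rewrite (val_orbit_act Gh Pg (v_rho_neq0 Gg)) rho_mul mulmxA.
- move=> P /inY[g Gg Pg]; apply: val_inj.
  rewrite (val_orbit_act GL_pair_one Pg (v_rho_neq0 Gg)) rho_one mulmx1.
  by rewrite (line_eq Pg (v_rho_neq0 Gg)).
- move=> P h k /inY[g Gg Pg] Gh Gk; apply: val_inj.
  rewrite (val_orbit_act (GL_pair_mul Gh Gk) Pg (v_rho_neq0 Gg)).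
  rewrite (val_orbit_act Gk (x := v *m rho g *m rho h)).
  + by rewrite rho_mul !mulmxA.
  + by rewrite (val_orbit_act Gh Pg (v_rho_neq0 Gg)) memv_line.
  by rewrite mulmx_unit_neq0 ?rho_unit ?v_rho_neq0.
move=> P Q /inY[g Gg Pg] [h Gh QE]; have [k Gk gk] := GL_pair_inv Gg.
exists (Defs.mul_pair k h); first exact: GL_pair_mul.
apply: val_inj; rewrite (val_orbit_act (GL_pair_mul Gk Gh) Pg (v_rho_neq0 Gg)) QE.
rewrite -mulmxA -rho_mul; congr <[v *m rho _]>%VS.
move: gk; rewrite /Defs.mul_pair /Defs.one_pair /= => -[gk1 gk2].
by rewrite !mulmxA gk1 gk2 !mul1mx; case: h {Gh QE}.
Qed.

End GroupOrbit.

(** * Minors of products *)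

Section WedgeIndices.
Variables r n : nat.
Implicit Types I J : wedge_index r n.

Lemma wedge_index_lt I (i j : 'I_r) : (i < j)%N -> (val I i < val I j)%N.
Proof. by have /forallP/(_ i)/forallP/(_ j)/implyP := valP I. Qed.

Lemma wedge_index_inj I : injective (val I).
Proof.
move=> i j Iij; apply: val_inj; case: (ltngtP i j) => // /(wedge_index_lt I).
  by rewrite Iij ltnn.
by rewrite Iij ltnn.
Qed.

Lemma wedge_index_ltE I (i j : 'I_r) : (val I i < val I j)%N = (i < j)%N.
Proof.
apply/idP/idP => [|/wedge_index_lt -> //]; apply: contraTT; rewrite -!leqNgt.
rewrite [(j <= i)%N]leq_eqVlt => /predU1P[/val_inj -> //|/(wedge_index_lt I)].
exact: ltnW.
Qed.

Lemma increasing_ord_ge (f : 'I_r -> 'I_r) :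
  (forall i j : 'I_r, (i < j)%N -> (f i < f j)%N) -> forall i : 'I_r, (i <= f i)%N.
Proof.
move=> f_inc [k lt_kr] /=; elim: k lt_kr => // k IH lt_kr.
apply: leq_ltn_trans (IH (ltnW lt_kr)) _; exact: f_inc.
Qed.

(** The permutation is increasing, hence the identity. *)
Lemma wedge_index_perm I J (s : 'S_r) :
  (forall i, val I i = val J (s i)) -> I = J /\ s = 1%g.
Proof.
move=> IJ; have s_lt (i j : 'I_r) : (s i < s j)%N = (i < j)%N.
  by rewrite -(wedge_index_ltE J) -!IJ wedge_index_ltE.
have s1 : s = 1%g.
  apply/permP => i; rewrite perm1; apply/val_inj/eqP; rewrite /= eqn_leq.
  rewrite (@increasing_ord_ge s) ?andbT; last by move=> ? ?; rewrite s_lt.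
  have := @increasing_ord_ge (s^-1)%g _ (s i); rewrite permK; apply=> j k.
  by rewrite -[X in _ -> is_true X]s_lt !permKV.
by split=> //; apply/val_inj/ffunP => i; rewrite IJ s1 perm1.
Qed.

(** Sorting the values of an injection: the permutation sends a position to the
    rank of its value. *)
Lemma injective_sort (f : {ffun 'I_r -> 'I_n}) : injective f ->
  exists (I : wedge_index r n) (s : 'S_r), f = [ffun i => val I (s i)].
Proof.
move=> f_inj; pose below i := [set j | (f j < f i)%N]%SET.
have below_lt i : (#|below i| < r)%N.
  rewrite -[X in (_ < X)%N]card_ord -cardsT; apply/proper_card/properP.
  by split; [apply/fintype.subsetP => j; rewrite inE | exists i; rewrite ?inE ?ltnn].
have rank_mono i j : (f i < f j)%N -> (#|below i| < #|below j|)%N.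
  move=> fij; apply/proper_card/properP; split.
    by apply/fintype.subsetP => k; rewrite !inE => /ltn_trans; apply.
  by exists i; rewrite inE ?ltnn.
have rank_inj : injective (fun i => Ordinal (below_lt i)).
  move=> i j [rij]; apply/f_inj/val_inj.
  by case: (ltngtP (f i) (f j)) => // /rank_mono; rewrite rij ltnn.
pose s := perm rank_inj; pose g := [ffun i => f ((s^-1)%g i)].
have gP : [forall i : 'I_r, forall j : 'I_r, (i < j)%N ==> (g i < g j)%N].
  apply/forallP => i; apply/forallP => j.
  have [a ->] : exists a, i = s a by exists ((s^-1)%g i); rewrite permKV.
  have [b ->] : exists b, j = s b by exists ((s^-1)%g j); rewrite permKV.
  rewrite !ffunE !permK !permE /=; apply/implyP; apply: contraTT; rewrite -!leqNgt.
  rewrite leq_eqVlt => /predU1P[/val_inj/f_inj -> //|/rank_mono]; exact: ltnW.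
exists (exist _ g gP), s; apply/ffunP => i; by rewrite !ffunE permK.
Qed.

End WedgeIndices.

Section CauchyBinet.
Variable R : comNzRingType.

(** Cauchy-Binet formula. Expanding every row of the product gives a sum over
    all maps from the rows to the intermediate indices; only injective maps
    contribute, and each of these is an increasing one composed with a
    permutation. *)
Lemma det_mulmx_minors r n (A : 'M[R]_(r, n)) (B : 'M[R]_(n, r)) :
  \det (A *m B) =
    \sum_(I : wedge_index r n) \det (colsub (val I) A) * \det (rowsub (val I) B).
Proof.
pose G (f : {ffun 'I_r -> 'I_n}) := \prod_i A i (f i) * \det (rowsub f B).
transitivity (\sum_f G f).
  transitivity (\sum_(f : {ffun 'I_r -> 'I_n}) \sum_(s : 'S_r)
      (-1) ^+ s * \prod_i (A i (f i) * B (f i) (s i))).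
    rewrite exchange_big; apply: eq_bigr => /= s _; rewrite -big_distrr /=.
    congr (_ * _).
    rewrite -(bigA_distr_bigA (fun i k => A i k * B k (s i))) /=.
    by apply: eq_bigr => i _; rewrite mxE.
  apply: eq_bigr => f _; rewrite /G big_distrr /=; apply: eq_bigr => s _.
  rewrite mulrCA big_split /=; congr (_ * (_ * _)).
  by apply: eq_bigr => i _; rewrite mxE.
rewrite (bigID (fun f : {ffun 'I_r -> 'I_n} => injectiveb f)) /= addrC.
rewrite big1 ?add0r => [|f /injectivePn[i1 [i2 Di Ef]]]; last first.
  rewrite /G (determinant_alternate Di) ?mulr0 // => j.
  by rewrite !mxE Ef.
pose h (u : wedge_index r n * 'S_r) := [ffun i => val u.1 (u.2 i)].
have h_inj : {in [set: wedge_index r n * 'S_r]%SET &, injective h}.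
  move=> [I s] [J t] _ _ /ffunP hIJ.
  have [|-> st] := @wedge_index_perm _ _ I J (s^-1 * t)%g.
    by move=> i; have := hIJ ((s^-1)%g i); rewrite !ffunE /= permKV permM.
  by congr pair; rewrite -[t]mul1g -(mulgV s) -mulgA st mulg1.
transitivity (\sum_(f in (h @: [set: wedge_index r n * 'S_r])%SET) G f).
  apply: eq_bigl => f; apply/injectiveP/imsetP => [/injective_sort[I [s ->]]|].
    by exists (I, s).
  by case=> [[I s] _ ->] i j; rewrite !ffunE => /wedge_index_inj/perm_inj.
rewrite big_imset //= (eq_bigl predT) => [|u]; last by rewrite inE.
transitivity (\sum_(I : wedge_index r n) \sum_(s : 'S_r) G (h (I, s))).
  by rewrite pair_bigA; apply: eq_bigr => -[].
apply: eq_bigr => I _; rewrite big_distrl /=; apply: eq_bigr => s _.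
rewrite /G (_ : rowsub _ B = row_perm s (rowsub (val I) B)); last first.
  by apply/matrixP => i j; rewrite !mxE ffunE.
rewrite row_permE det_mulmx det_perm mulrA; congr (_ * _); rewrite mulrC.
by congr (_ * _); apply: eq_bigr => i _; rewrite !mxE ffunE.
Qed.

Lemma det_neq0_perm n (A : 'M[R]_n) :
  \det A != 0 -> exists s : 'S_n, forall i, A i (s i) != 0.
Proof.
move=> /eqP detA; apply: contrapT => nos; apply: detA.
rewrite /determinant big1 // => s _; have [i Ai0] : exists i, A i (s i) = 0.
  apply: contrapT => noi; apply: nos; exists s => i; apply/eqP => Ai0.
  by apply: noi; exists i.
by rewrite (bigD1 i) //= Ai0 mul0r mulr0.
Qed.

End CauchyBinet.

(** * Block diagonal matrices acting on Pluecker coordinates *)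

Section BlockMinors.
Variable K : closedFieldType.
Variables k h1 h2 a1 a2 : nat.
Local Notation n1 := h1.+1.
Local Notation n2 := h2.+1.
Local Notation r := k.+1.
Local Notation windex := (wedge_index r (n1 + n2)).
Local Notation bindex := (bidegree_index r n1 n2 a1 a2).
Local Notation pair := (@matrix_pair K n1 n2).
Local Notation rho := (@bifocal_matrix K k h1 h2 a1 a2).

Definition diag_pair (g : pair) : 'M[K]_(n1 + n2) := block_mx g.1 0 0 g.2.

Lemma diag_pair_mul g h : diag_pair (Defs.mul_pair g h) = diag_pair g *m diag_pair h.
Proof.
by rewrite /diag_pair mulmx_block !mulmx0 !mul0mx !addr0 add0r.
Qed.

Lemma diag_pair_same_block (g : pair) x y : diag_pair g x y != 0 ->
  (x < n1)%N = (y < n1)%N.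
Proof.
by case: (split_ordP x) => i ->; case: (split_ordP y) => j -> /=;
  rewrite ?ltn_ord ?(ltnNge (n1 + _)) ?leq_addr // /diag_pair
    ?block_mxEur ?block_mxEdl mxE eqxx.
Qed.

Definition has_bidegree (I : windex) :=
  (#|[pred i | (val I i < n1)%N]| == a1) && (#|[pred i | (n1 <= val I i)%N]| == a2).

(** A nonzero term of the Leibniz formula matches the rows and the columns of a
    minor of a block diagonal matrix within the blocks. *)
Lemma minor_diag_pair_bidegree (g : pair) (I J : windex) : has_bidegree J ->
  \det (mxsub (val I) (val J) (diag_pair g)) != 0 -> has_bidegree I.
Proof.
move=> /andP[/eqP J1 /eqP J2] /det_neq0_perm[s sP].
have IJ i : (val I i < n1)%N = (val J (s i) < n1)%N.
  by apply: (@diag_pair_same_block g); have := sP i; rewrite mxE.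
apply/andP; split; apply/eqP.
  rewrite -J1 -!sum1_card [RHS](reindex_perm s) /=.
  by apply: eq_bigl => i; rewrite !inE IJ.
rewrite -J2 -!sum1_card [RHS](reindex_perm s) /=.
by apply: eq_bigl => i; rewrite !inE leqNgt IJ -leqNgt.
Qed.

Lemma sum_bidegree_index (F : windex -> K) :
  (forall I, ~~ has_bidegree I -> F I = 0) ->
  \sum_I F I = \sum_(i < bidegree_dim r n1 n2 a1 a2) F (val (enum_val i : bindex)).
Proof.
move=> F0; rewrite (bigID has_bidegree) /= [X in _ + X]big1 ?addr0 //.
transitivity (\sum_(I in ([set val u | u in [set: bindex]])%SET) F I).
  apply: eq_bigl => I; apply/idP/imsetP => [bI|[u _ ->]]; last exact: (valP u).
  by exists (exist _ I bI); rewrite ?inE.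
rewrite big_imset; last exact: in2W val_inj.
rewrite (eq_bigl predT) => [|u]; last by rewrite inE.
exact: (@big_enum_val _ _ _ _ predT (fun u : bindex => F (val u))).
Qed.

Lemma det_mxsub_diag_pair (g : pair) (I J : windex) :
  \det (mxsub (val I) (val J) (diag_pair g)) =
    pluecker_coordinates (rowsub (val I) (diag_pair g)) 0 (enum_rank J).
Proof.
by rewrite mxE enum_rankK; congr (\det _); apply/matrixP => i j; rewrite !mxE.
Qed.

(** In the Cauchy-Binet expansion of a minor of bidegree (a1, a2), the terms of
    any other bidegree contain a minor of the block diagonal matrix that
    vanishes. *)
Lemma bidegree_part_diag_pair (M : 'M[K]_(r, n1 + n2)) (g : pair) :
  bidegree_part a1 a2 (pluecker_coordinates (M *m diag_pair g)) =
    bidegree_part a1 a2 (pluecker_coordinates M) *m rho g.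
Proof.
apply/rowP => j; rewrite !mxE enum_rankK; set J := val (val (enum_val j)).
have -> : colsub J (M *m diag_pair g) = M *m colsub J (diag_pair g).
  by apply/matrixP => x y; rewrite !mxE; apply: eq_bigr => z _; rewrite !mxE.
rewrite det_mulmx_minors sum_bidegree_index => [|I nbI].
  apply: eq_bigr => i _; rewrite !mxE enum_rankK; congr (_ * _).
  by congr (\det _); apply/matrixP => x y; rewrite !mxE.
rewrite (_ : rowsub _ _ = mxsub (val I) J (diag_pair g)); last first.
  by apply/matrixP => x y; rewrite !mxE.
suff -> : \det (mxsub (val I) J (diag_pair g)) = 0 by rewrite mulr0.
apply/eqP; apply: contraNT nbI; apply: minor_diag_pair_bidegree.
exact: valP (enum_val j).
Qed.

(** The rows of the representing matrix are themselves projected Pluecker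
    coordinates, so this is a case of [bidegree_part_diag_pair]. *)
Lemma bifocal_matrix_mul (g h : pair) : rho (Defs.mul_pair g h) = rho g *m rho h.
Proof.
apply/row_matrixP => i; rewrite row_mul.
have rowE (f : pair) : row i (rho f) = bidegree_part a1 a2 (pluecker_coordinates
    (rowsub (val (val (enum_val i : bindex))) (diag_pair f))).
  apply/rowP => j; rewrite [LHS]mxE [LHS]mxE [RHS]mxE.
  exact: det_mxsub_diag_pair.
rewrite !rowE -bidegree_part_diag_pair diag_pair_mul; congr (bidegree_part _ _ _).
congr pluecker_coordinates.
by apply/matrixP => x y; rewrite !mxE; apply: eq_bigr => z _; rewrite !mxE.
Qed.

Lemma bifocal_matrix_one : rho (@Defs.one_pair K n1 n2) = 1%:M.
Proof.
apply/matrixP => i j; rewrite !mxE /= -scalar_mx_block.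
set I := val (enum_val i); set J := val (enum_val j).
have [ij|nij] := eqVneq i j.
  rewrite {}/I ij -/J.
  rewrite (_ : mxsub _ _ _ = 1%:M) ?det1 //; apply/matrixP => x y; rewrite !mxE.
  by rewrite (inj_eq (@wedge_index_inj _ _ _)).
apply/eqP; apply: contraNT nij => /det_neq0_perm[s sP].
suff [IJ _] : I = J /\ s = 1%g by apply/eqP/enum_val_inj/val_inj.
apply: wedge_index_perm => x; have := sP x; rewrite !mxE.
by case: (val I x =P val J (s x)) => // _; rewrite eqxx.
Qed.

Lemma polyfun_bifocal_matrix i j :
  polyfun (fun y => rho (@pair_of_entries K n1 n2 y) i j).
Proof.
set I := val (val (enum_val i : bindex)); set J := val (val (enum_val j : bindex)).
have pD x z : polyfun (fun y => diag_pair (@pair_of_entries K n1 n2 y) x z).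
  case: (split_ordP x) => u ->; case: (split_ordP z) => v ->.
  - apply: polyfun_ext (polyfun_entry1 K n2 u v) => y.
    by rewrite /diag_pair block_mxEul.
  - apply: polyfun_ext (polyfun_const _ 0) => y.
    by rewrite /diag_pair block_mxEur mxE.
  - apply: polyfun_ext (polyfun_const _ 0) => y.
    by rewrite /diag_pair block_mxEdl mxE.
  apply: polyfun_ext (polyfun_entry2 K n1 u v) => y.
  by rewrite /diag_pair block_mxEdr.
apply: (@polyfun_ext _ _ (fun y =>
    \det (mxsub I J (diag_pair (@pair_of_entries K n1 n2 y))))) => [y|].
  by rewrite mxE.
apply: polyfun_det => u v; apply: polyfun_ext (pD (I u) (J v)) => y.
by rewrite [RHS]mxE.
Qed.

End BlockMinors.

(** * Pairs of disjoint subspaces *)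

Section PairsOfSubspaces.
Variable K : fieldType.

Lemma exists_row_base r c (X : 'M[K]_r) : \rank X = c ->
  exists B : 'M[K]_(c, r), (B :=: X)%MS.
Proof. by move=> <-; exists (row_base X); apply: eq_row_base. Qed.

Lemma adapted_basis (r c1 c2 : nat) (C1 C2 : 'M[K]_r) :
  \rank C1 = c1 -> \rank C2 = c2 -> (C1 :&: C2)%MS = 0 ->
  exists (B1 : 'M[K]_(c1, r)) (B2 : 'M[K]_(c2, r)) (B3 : 'M[K]_(r - (c1 + c2), r)),
    [/\ (B1 :=: C1)%MS, (B2 :=: C2)%MS,
        row_free (col_mx (col_mx B1 B2) B3) & row_full (col_mx (col_mx B1 B2) B3)].
Proof.
move=> rk1 rk2 C12.
have rk12 : \rank (C1 + C2)%MS = (c1 + c2)%N by rewrite mxrank_disjoint_sum ?rk1 ?rk2.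
have [B1 eB1] := exists_row_base rk1; have [B2 eB2] := exists_row_base rk2.
have [|B3 eB3] := @exists_row_base r (r - (c1 + c2))%N ((C1 + C2)^C)%MS.
  by rewrite mxrank_compl rk12.
exists B1, B2, B3.
suff full : row_full (col_mx (col_mx B1 B2) B3).
  split=> //; rewrite /row_free (eqP full) subnKC //.
  by rewrite -rk12 rank_leq_row.
rewrite -sub1mx -addsmxE; apply: submx_trans (_ : _ <= (C1 + C2) + (C1 + C2)^C)%MS _.
  by rewrite sub1mx addsmx_compl_full.
by apply: addsmxS; rewrite ?eB3 // -addsmxE; apply: addsmxS; rewrite ?eB1 ?eB2.
Qed.

(** Bases of two disjoint subspaces extend together to a basis of the whole
    space, and [A] carries one such adapted basis to the other. *)
Lemma disjoint_subspaces_equiv r (C1 C2 D1 D2 : 'M[K]_r) :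
  \rank C1 = \rank D1 -> \rank C2 = \rank D2 ->
  (C1 :&: C2)%MS = 0 -> (D1 :&: D2)%MS = 0 ->
  exists2 A : 'M[K]_r, A \in unitmx &
    (C1 *m A :=: D1)%MS /\ (C2 *m A :=: D2)%MS.
Proof.
move=> rk1 rk2 C12 D12.
have [B1 [B2 [B3 [eB1 eB2 freeB fullB]]]] := adapted_basis rk1 rk2 C12.
have [E1 [E2 [E3 [eE1 eE2 freeE fullE]]]] := adapted_basis erefl erefl D12.
set B := col_mx _ B3 in freeB fullB; set E := col_mx _ E3 in freeE fullE.
pose A := pinvmx B *m E.
have BA : B *m A = E by rewrite /A mulmxA mulmxVp // mul1mx.
exists A.
  have : A *m (pinvmx E *m B) = 1%:M.
    by rewrite /A mulmxA -(mulmxA _ E) mulmxVp // mulmx1 mulVpmx.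
  by case/mulmx1_unit.
move: BA; rewrite /B /E !mul_col_mx => /eq_col_mx[/eq_col_mx[BA1 BA2] _].
split; first by apply: eqmx_trans (eqmxMr A (eqmx_sym eB1)) _; rewrite BA1.
by apply: eqmx_trans (eqmxMr A (eqmx_sym eB2)) _; rewrite BA2.
Qed.

(** The left kernel is the annihilator of the column space, so an inclusion of
    left kernels gives an opposite inclusion of column spaces, that is a
    factorization; the rank makes the factor invertible. *)
Lemma same_kernel_equiv r n (M N : 'M[K]_(r, n)) : \rank M = n ->
  (forall u : 'rV_r, u *m N = 0 -> u *m M = 0) ->
  exists2 H : 'M[K]_n, H \in unitmx & M = N *m H.
Proof.
move=> rkM NM; have /submxP[D MD] : (M^T <= N^T)%MS.
  rewrite submxE -trmx_eq0 trmx_mul trmxK; apply/eqP/row_matrixP => i.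
  rewrite row_mul row0; apply: NM; rewrite -row_mul.
  by rewrite -[N in _ *m N]trmxK -trmx_mul mulmx_coker trmx0 row0.
have ME : M = N *m D^T by rewrite -[M]trmxK MD trmx_mul trmxK.
exists D^T => //; rewrite -row_free_unit /row_free eqn_leq rank_leq_row /=.
by rewrite -{1}rkM ME mxrankM_maxr.
Qed.

Lemma capmx_kermx_eq0P r n1 n2 (M1 : 'M[K]_(r, n1)) (M2 : 'M[K]_(r, n2)) :
  (kermx M1 :&: kermx M2)%MS = 0 <->
  (forall u : 'rV_r, u *m M1 = 0 -> u *m M2 = 0 -> u = 0).
Proof.
split=> [M12 u /eqP u1 /eqP u2|M12].
  by apply/eqP; rewrite -submx0 -M12 sub_capmx !sub_kermx u1 u2.
apply/eqP; rewrite -submx0; apply/rV_subP => u.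
by rewrite sub_capmx !sub_kermx => /andP[/eqP u1 /eqP u2]; rewrite (M12 u) ?sub0mx.
Qed.

End PairsOfSubspaces.

(** * The projected open set is an orbit *)

Section BifocalOrbit.
Variable K : closedFieldType.
Variables k h1 h2 : nat.
Local Notation r := k.+1.
Local Notation n1 := h1.+1.
Local Notation n2 := h2.+1.

(** A change of basis of the source matches both pairs of kernels; what is left
    is a change of basis in each of the two targets. *)
Lemma W0_equiv (M1 N1 : 'M[K]_(r, n1)) (M2 N2 : 'M[K]_(r, n2)) :
  W0 M1 M2 -> W0 N1 N2 ->
  exists2 A : 'M[K]_r, A \in unitmx & exists2 g, @GL_pair K n1 n2 g &
    row_mx M1 M2 = A *m (row_mx N1 N2 *m diag_pair g).
Proof.
move=> [rkM1 rkM2 M12] [rkN1 rkN2 N12].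
have rk_ker n (M N : 'M[K]_(r, n)) : \rank M = n -> \rank N = n ->
  \rank (kermx M) = \rank (kermx N) by move=> rkM rkN; rewrite !mxrank_ker rkM rkN.
have [A Au [A1 A2]] := disjoint_subspaces_equiv (rk_ker _ _ _ rkM1 rkN1)
  (rk_ker _ _ _ rkM2 rkN2) M12 N12.
have ker n (M N : 'M[K]_(r, n)) : (kermx M *m A :=: kermx N)%MS ->
    forall u : 'rV_r, u *m (A *m N) = 0 -> u *m M = 0.
  move=> MN u; rewrite mulmxA => /sub_kermxP; rewrite -MN submxMfree ?row_free_unit //.
  by move/sub_kermxP.
have [H1 H1u M1E] := same_kernel_equiv rkM1 (ker _ _ _ A1).
have [H2 H2u M2E] := same_kernel_equiv rkM2 (ker _ _ _ A2).
exists A => //; exists (H1, H2); first by split.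
by rewrite /diag_pair mul_row_block !mulmx0 addr0 add0r mul_mx_row !mulmxA -M1E -M2E.
Qed.

Lemma W0_act (M1 : 'M[K]_(r, n1)) (M2 : 'M[K]_(r, n2)) g :
  W0 M1 M2 -> @GL_pair K n1 n2 g -> W0 (M1 *m g.1) (M2 *m g.2).
Proof.
move=> [rkM1 rkM2 /capmx_kermx_eq0P M12] [g1 g2].
split; rewrite ?mxrankMfree ?row_free_unit //; apply/capmx_kermx_eq0P => u.
rewrite !mulmxA => u1 u2; apply: M12.
  by rewrite -[LHS](mulmxK g1) u1 mul0mx.
by rewrite -[LHS](mulmxK g2) u2 mul0mx.
Qed.

Lemma W0_row_free (M1 : 'M[K]_(r, n1)) (M2 : 'M[K]_(r, n2)) :
  W0 M1 M2 -> row_free (row_mx M1 M2).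
Proof.
move=> [_ _ /capmx_kermx_eq0P M12]; apply: inj_row_free => u.
by rewrite mul_mx_row => /eqP; rewrite row_mx_eq0 => /andP[/eqP u1 /eqP u2]; apply: M12.
Qed.

Lemma row_space_exists n (M : 'M[K]_(r, n)) : row_free M ->
  exists L : @grassmannian K r n, is_row_space M (val L).
Proof.
move=> freeM; pose f := linfun (mulmxr M : 'rV[K]_r -> 'rV[K]_n).
have dimL : \dim (f @: fullv) == r.
  rewrite limg_dim_eq ?dimvf /dim /= ?mul1n //; apply/eqP; rewrite -subv0.
  apply/subvP => u; rewrite memv_cap memv_ker lfunE memvf /= => /eqP uM.
  by rewrite memv0; apply/eqP/(row_free_inj freeM); rewrite uM mul0mx.
exists (exist (fun L : {vspace _} => \dim L == r) _ dimL) => v.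
apply/memv_imgP/submxP => [[u _ ->]|[u ->]].
  by exists u; rewrite lfunE.
by exists u; rewrite ?memvf // lfunE.
Qed.

Lemma pluecker_coordinates_scale n (A : 'M[K]_r) (M : 'M[K]_(r, n)) :
  pluecker_coordinates (A *m M) = \det A *: pluecker_coordinates M.
Proof.
apply/rowP => i; rewrite !mxE -det_mulmx; congr (\det _).
by apply/matrixP => x y; rewrite !mxE; apply: eq_bigr => z _; rewrite !mxE.
Qed.

Variables a1 a2 : nat.

Lemma bidegree_part_scale c x :
  @bidegree_part K r n1 n2 a1 a2 (c *: x) = c *: bidegree_part a1 a2 x.
Proof. by apply/rowP => i; rewrite !mxE. Qed.

Variables (N1 : 'M[K]_(r, n1)) (N2 : 'M[K]_(r, n2)).
Hypothesis W0N : W0 N1 N2.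
Let v := bidegree_part a1 a2 (pluecker_coordinates (row_mx N1 N2)).
Hypothesis v0 : v != 0.

Local Notation rho := (@bifocal_matrix K k h1 h2 a1 a2).

(** Replacing a matrix by another one with the same row space, or [M1|M2] by
    [A M1|A M2], rescales all the coordinates, so only the right action moves
    the point. *)
Lemma projected_Q0_orbit :
  @projected_Q0 K k h1 h2 a1 a2 = orbit_of_line rho v.
Proof.
apply/seteqP; split=> P' [].
  move=> L [P [[M1 [M2 [W0M LM]]] [N LN PN] [x Px P'x]]].
  have /submxP[B NB] : (N <= row_mx M1 M2)%MS.
    by apply/rV_subP => u; rewrite -LN LM.
  have [A Au [g Gg ME]] := W0_equiv W0M W0N.
  exists g => //.
  have [c xE] : exists c, bidegree_part a1 a2 x = c *: (v *m rho g).
    move: Px; rewrite PN => /vlineP[c ->]; exists (c * (\det B * \det A)).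
    rewrite NB ME !pluecker_coordinates_scale !scalerA bidegree_part_scale.
    by rewrite bidegree_part_diag_pair.
  have c0 : c != 0.
    apply: contraTneq (valP P') => c0.
    by rewrite /= P'x xE c0 scale0r dim_vline eqxx.
  apply: line_eq.
    rewrite P'x; apply/vlineP; exists c^-1.
    by rewrite xE scalerA mulVf // scale1r.
  apply: v_rho_neq0 => //; [exact: bifocal_matrix_mul | exact: bifocal_matrix_one].
move=> g Gg P'E.
have bE : bidegree_part a1 a2 (pluecker_coordinates (row_mx N1 N2 *m diag_pair g)) =
    v *m rho g by exact: bidegree_part_diag_pair.
have W0g := W0_act W0N Gg; have [L LE] := row_space_exists (W0_row_free W0g).
have NgE : row_mx N1 N2 *m diag_pair g = row_mx (N1 *m g.1) (N2 *m g.2).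
  by rewrite /diag_pair mul_row_block !mulmx0 addr0 add0r.
have pl0 : pluecker_coordinates (row_mx N1 N2 *m diag_pair g) != 0.
  apply: contraTneq (valP P') => pl0; rewrite /= P'E -bE pl0.
  by rewrite -[0](scale0r 0) bidegree_part_scale !scale0r dim_vline eqxx.
exists L, (line_of pl0); split.
- by exists (N1 *m g.1), (N2 *m g.2).
- by exists (row_mx N1 N2 *m diag_pair g); rewrite // NgE.
exists (pluecker_coordinates (row_mx N1 N2 *m diag_pair g)).
  exact: memv_line.
by rewrite bE.
Qed.

End BifocalOrbit.

(** * A point with nonzero coordinates of the given bidegree *)

Section Witness.
Variable K : closedFieldType.
Variables k h1 h2 a1 a2 : nat.
Local Notation r := k.+1.
Local Notation n1 := h1.+1.
Local Notation n2 := h2.+1.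
Hypotheses (h1k : (h1 < k)%N) (h2k : (h2 < k)%N) (a_sum : (a1 + a2 = r)%N).
Hypotheses (a1h1 : (a1 <= h1)%N) (a2h2 : (a2 <= h2)%N).

Definition selection_mx n (f : 'I_n -> 'I_r) : 'M[K]_(r, n) :=
  \matrix_(i, j) (i == f j)%:R.

Lemma mul_selection_mx n (f : 'I_n -> 'I_r) (u : 'rV[K]_r) j :
  (u *m selection_mx f) 0 j = u 0 (f j).
Proof.
rewrite mxE (bigD1 (f j)) //= mxE eqxx mulr1 big1 ?addr0 // => i /negPf.
by rewrite mxE => ->; rewrite mulr0.
Qed.

Lemma rank_selection_mx n (f : 'I_n -> 'I_r) : injective f ->
  \rank (selection_mx f) = n.
Proof.
move=> f_inj; apply/eqP; rewrite eqn_leq rank_leq_col /=.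
have fT : (selection_mx f)^T *m selection_mx f = 1%:M.
  apply/matrixP => i j.
  have -> : ((selection_mx f)^T *m selection_mx f) i j =
      (row i (selection_mx f)^T *m selection_mx f) 0 j by rewrite -row_mul [RHS]mxE.
  by rewrite mul_selection_mx !mxE eq_sym (inj_eq f_inj).
by rewrite -{1}(mxrank1 K n) -fT mxrankM_maxr.
Qed.

(** The columns of the two matrices are the first [n1] basis vectors, and [n2]
    cyclically consecutive ones starting at position [a1]. The first [a1] of the
    former and the first [a2] of the latter form the whole basis in order. *)
Definition first_columns (j : 'I_n1) : 'I_r := inord j.
Definition last_columns (j : 'I_n2) : 'I_r := inord ((a1 + j) %% r).

Lemma witness_W0 :
  W0 (selection_mx first_columns) (selection_mx last_columns).
Proof.
have n1r (j : 'I_n1) : (j < r)%N by apply: leq_trans (ltn_ord j) _; apply: ltnW.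
have n2r (j : 'I_n2) : (j < r)%N by apply: leq_trans (ltn_ord j) _; apply: ltnW.
split.
- apply: rank_selection_mx => i j /(congr1 val).
  by rewrite /= !inordK // => /val_inj.
- apply: rank_selection_mx => i j /(congr1 val); rewrite /= !inordK ?ltn_mod //.
  by move=> /eqP; rewrite eqn_modDl !modn_small // => /eqP/val_inj.
apply/capmx_kermx_eq0P => u /rowP u1 /rowP u2; apply/rowP => i; rewrite mxE.
case: (ltnP i n1) => [lt_i|le_i].
  have := u1 (Ordinal lt_i); rewrite mul_selection_mx mxE => <-.
  by congr (u 0 _); apply: val_inj; rewrite /= inordK.
have a1i : (a1 <= i)%N by apply: leq_trans a1h1 (ltnW le_i).
have lt_i : (i - a1 < n2)%N.
  by rewrite ltn_subLR // (leq_trans (ltn_ord i)) // -a_sum leq_add2l ltnW.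
have := u2 (Ordinal lt_i); rewrite mul_selection_mx mxE => <-.
by congr (u 0 _); apply: val_inj; rewrite /= inordK ?ltn_mod // subnKC // modn_small.
Qed.

Definition witness_columns : {ffun 'I_r -> 'I_(n1 + n2)} :=
  [ffun t : 'I_r => if (t < a1)%N then lshift n2 (inord t : 'I_n1)
                    else rshift n1 (inord (t - a1) : 'I_n2)].

Lemma val_witness_columns (t : 'I_r) :
  val (witness_columns t) = if (t < a1)%N then t : nat else (n1 + (t - a1))%N.
Proof.
rewrite ffunE; case: ltnP => t_a1 /=; rewrite inordK //.
  by apply: leq_trans t_a1 (leqW a1h1).
by rewrite ltn_subLR // (leq_trans (ltn_ord t)) // -a_sum leq_add2l ltnW.
Qed.

Lemma witness_columns_increasing :
  [forall i : 'I_r, forall j : 'I_r,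
    (i < j)%N ==> (witness_columns i < witness_columns j)%N].
Proof.
apply/forallP => i; apply/forallP => j; apply/implyP => lt_ij.
have := (val_witness_columns i, val_witness_columns j) => /= -[-> ->].
case: (ltnP i a1) => i_a1; case: (ltnP j a1) => j_a1 //.
- by rewrite (leq_trans i_a1) // (leq_trans a1h1) // (leq_trans (leqnSn _)) ?leq_addr.
- by have := leq_ltn_trans i_a1 (ltn_trans lt_ij j_a1); rewrite ltnn.
by rewrite ltn_add2l ltn_sub2r // (leq_ltn_trans i_a1).
Qed.

Definition witness_windex : wedge_index r (n1 + n2) :=
  exist _ witness_columns witness_columns_increasing.

Lemma witness_bidegree : has_bidegree a1 a2 witness_windex.
Proof.
have lt_n1 t : (witness_columns t < n1)%N = (t < a1)%N.
  rewrite -[nat_of_ord _]/(val _) val_witness_columns; case: ifP => [t_a1|_].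
    by apply: leq_trans t_a1 (leqW a1h1).
  by apply/negbTE; rewrite -leqNgt leq_addr.
have card1 : #|[pred i | (val witness_windex i < n1)%N]| = a1.
  rewrite -sum1_card (eq_bigl (fun t : 'I_r => (t < a1)%N)); last first.
    by move=> t; rewrite inE /= lt_n1.
  by rewrite -(big_ord_widen r (fun _ => 1%N)) ?sum1_card ?card_ord // -a_sum leq_addr.
rewrite /has_bidegree card1 eqxx /=.
apply/eqP/(@addnI a1); rewrite a_sum -[RHS](card_ord r).
rewrite -(cardC [pred i | (val witness_windex i < n1)%N]) card1.
by congr (_ + _)%N; apply: eq_card => t; rewrite !inE leqNgt.
Qed.

Lemma witness_neq0 : bidegree_part a1 a2 (pluecker_coordinates
  (row_mx (selection_mx first_columns) (selection_mx last_columns))) != 0.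
Proof.
pose J : bidegree_index r n1 n2 a1 a2 := exist _ witness_windex witness_bidegree.
apply/eqP => /rowP/(_ (enum_rank J)) /eqP; rewrite !mxE !enum_rankK.
rewrite (_ : colsub _ _ = 1%:M) ?det1 ?oner_eq0 //.
apply/matrixP => s t; rewrite mxE [RHS]mxE ffunE.
case: ltnP => t_a1; rewrite ?row_mxEl ?row_mxEr mxE.
  have t_n1 : (t < n1)%N := leq_trans t_a1 (leqW a1h1).
  congr (_ == _)%:R; apply: val_inj.
  by rewrite /first_columns (inordK t_n1) inord_val.
have t_n2 : (t - a1 < n2)%N.
  by rewrite ltn_subLR // (leq_trans (ltn_ord t)) // -a_sum leq_add2l ltnW.
congr (_ == _)%:R; apply: val_inj.
by rewrite /last_columns (inordK t_n2) subnKC // modn_small // inord_val.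
Qed.

End Witness.

Theorem theorem1 (R : realType) (k h1 h2 : nat)
  (k_gt0 : (0 < k)%N) (h1_gt0 : (0 < h1)%N) (h2_gt0 : (0 < h2)%N)
  (k_gt_max : (maxn h1 h2 < k)%N) (k_le : (k <= h1 + h2 + 1)%N)
  (a1 a2 : nat) (a_sum : (a1 + a2 = k + 1)%N)
  (a1_bounds : (1 <= a1 <= h1)%N) (a2_bounds : (1 <= a2 <= h2)%N) :
  let X := @bifocal_variety R[i] k h1 h2 a1 a2 in
  exists (m : nat) (Y : set (@projective R[i] m))
         (act : @projective R[i] m -> @matrix_pair R[i] h1.+1 h2.+1 ->
                @projective R[i] m),
    homogeneous_space Y act /\
    exists U f V g,
      birational_equivalence X Y U f V g /\
      (forall P H, U P -> GL_pair H -> U (bifocal_act P H) ->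
         f (bifocal_act P H) = act (f P) H).
Proof.
move=> X; rewrite addn1 in a_sum.
have /andP[_ a1h1] := a1_bounds; have /andP[_ a2h2] := a2_bounds.
move: k_gt_max; rewrite gtn_max => /andP[h1k h2k].
have W0w := witness_W0 R[i] h1k h2k a_sum a1h1 a2h2.
have w0 := witness_neq0 R[i] a_sum a1h1 a2h2.
have rhoM := @bifocal_matrix_mul R[i] k h1 h2 a1 a2.
have rho1 := @bifocal_matrix_one R[i] k h1 h2 a1 a2.
have rhoP := @polyfun_bifocal_matrix R[i] k h1 h2 a1 a2.
have YE := projected_Q0_orbit W0w w0.
have irrY := orbit_irreducible rhoP rhoM rho1 w0.
have openY := orbit_open rhoP rhoM rho1 w0.
exists _, (@projected_Q0 R[i] k h1 h2 a1 a2), (@bifocal_act R[i] k h1 h2 a1 a2).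
split; first by rewrite YE; apply: homogeneous_orbit.
exists (@projected_Q0 R[i] k h1 h2 a1 a2), id.
exists (@projected_Q0 R[i] k h1 h2 a1 a2), id.
by split=> //; apply: birational_closure; rewrite YE.
Qed.
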